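(* Let $r:\mathbb R\to(0,\infty)$ be continuous and let $0\le q\in L_1^{\rm loc}(\mathbb R)$. Let $p\in(1,\infty)$ and $p'=p(p-1)^{-1}$. The problem $$-r(x)y'(x)+q(x)y(x)=f(x),\quad x\in\mathbb R,\qquad \lim_{|x|\to\infty}y(x)=0$$ is correctly solvable in $L_p(\mathbb R)$ if and only if the following three conditions hold together: 1) $M_p:=\sup_{x\in\mathbb R}M_p(x)<\infty$, where $$M_p(x)=\Big[\int_{-\infty}^x\exp\Big(-p\int_t^x\frac{q(\xi)}{r(\xi)}d\xi\Big)dt\Big]^{1/p}\Big[\int_x^\infty\frac{1}{r(t)^{p'}}\exp\Big(-p'\int_x^t\frac{q(\xi)}{r(\xi)}d\xi\Big)dt\Big]^{1/p'};$$ 2) $S_1:=\int_{-\infty}^0\frac{q(t)}{r(t)}dt=\infty$; 3) $A_{p'}:=\sup_{x\in\mathbb R}A_{p'}(x)<\infty$, where $A_{p'}(x)=\int_{x-d(x)}^{x+d(x)}\frac{dt}{r(t)^{p'}}$. Moreover, the condition $M_p<\infty$ is necessary and sufficient for the operator $G:L_p(\mathbb R)\to L_p(\mathbb R)$ to be bounded, and $$M_p\le\|G\|_{p\to p}\le p^{1/p}(p')^{1/p'}M_p .$$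
   Context: $L_p(\mathbb R)$ is the usual Lebesgue space with norm $\|\cdot\|_p$. A solution of the problem (for given $f\in L_p(\mathbb R)$) is any function $y$ on $\mathbb R$, absolutely continuous on every compact interval, that satisfies the differential equation almost everywhere on $\mathbb R$ and satisfies $y(x)\to0$ as $|x|\to\infty$. The problem is called correctly solvable in $L_p(\mathbb R)$ if (I) for every $f\in L_p(\mathbb R)$ there exists a unique solution $y\in L_p(\mathbb R)$, and (II) there is a constant $c_p\in(0,\infty)$, independent of $f$, such that $\|y\|_p\le c_p\|f\|_p$ for all $f\in L_p(\mathbb R)$. When $S_1=\infty$, the function $d$ is defined for $x\in\mathbb R$ by $d(x)=\inf\{d>0:\int_{x-d}^{x+d}\frac{q(t)}{r(t)}dt=2\}$ (condition 3 is considered only when condition 2 holds, so that $d$ is defined). $G$ is the integral operator $(Gf)(x)=\int_x^\infty\frac{1}{r(t)}\exp\big(-\int_x^t\frac{q(s)}{r(s)}ds\big)f(t)\,dt$, $x\in\mathbb R$, and $\|G\|_{p\to p}$ is its operator norm on $L_p(\mathbb R)$. *)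

(* Defs.v *)
From mathcomp Require Import all_boot all_order all_algebra.
From mathcomp Require Import all_classical all_reals all_analysis.

Set Implicit Arguments.
Unset Strict Implicit.
Unset Printing Implicit Defensive.
Import Order.TTheory GRing.Theory Num.Theory.
Import numFieldNormedType.Exports.

Local Open Scope classical_set_scope.
Local Open Scope ring_scope.

(* The measurable sets of R are the Borel sets; a class of L_p or L_1^loc is
   given by any of its Borel representatives. *)

Section Definitions.
Context {R : realType}.
Local Notation mu := (@lebesgue_measure R).
Implicit Types (r q f y : R -> R) (p x : R).

Definition abs_continuous_on (a b : R) y : Prop :=
  forall e : R, 0 < e -> exists2 d : R, 0 < d &
    forall (n : nat) (u v : 'I_n -> R),
      (forall i, a <= u i /\ u i <= v i /\ v i <= b) ->
      trivIset [set: 'I_n] (fun i => `]u i, v i[%classic) ->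
      \sum_(i < n) (v i - u i) < d ->
      \sum_(i < n) `|y (v i) - y (u i)| < e.

Definition is_solution r q f y : Prop :=
  [/\ forall a b : R, a <= b -> abs_continuous_on a b y,
      {ae mu, forall x, derivable y x 1 /\
                        - r x * derive1 y x + q x * y x = f x},
      y x @[x --> -oo] --> (0 : R) &
      y x @[x --> +oo] --> (0 : R)].

Definition correctly_solvable r q p : Prop :=
  (forall f, f \in Lfun mu p%:E ->
     exists! y, is_solution r q f y /\ y \in Lfun mu p%:E) /\
  (exists2 c : R, 0 < c &
     forall f y, f \in Lfun mu p%:E ->
       is_solution r q f y -> y \in Lfun mu p%:E ->
       ('N[mu]_(p%:E)[EFin \o y] <= c%:E * 'N[mu]_(p%:E)[EFin \o f])%E).

Definition conj_exp p : R := p / (p - 1).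

Definition Mpx r q p x : \bar R :=
  let p' := conj_exp p in
  ((\int[mu]_(t in `]-oo, x])
      (expR (- p * \int[mu]_(s in `[t, x]) (q s / r s))%R)%:E) `^ p^-1 *
   (\int[mu]_(t in `[x, +oo[)
      ((r t `^ p')^-1 *
       expR (- p' * \int[mu]_(s in `[x, t]) (q s / r s)))%R%:E) `^ p'^-1)%E.

Definition Mp r q p : \bar R := ereal_sup (range (Mpx r q p)).

Definition S1 r q : \bar R := (\int[mu]_(t in `]-oo, 0%R]) (q t / r t)%:E)%E.

(* [inf] is 0 on the empty set; the set is nonempty when [S1 r q = +oo]. *)
Definition dfun r q x : R :=
  inf [set d : R | 0 < d /\
                   \int[mu]_(t in `[x - d, x + d]) (q t / r t) = 2].

Definition Apx r q p x : \bar R :=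
  (\int[mu]_(t in `[(x - dfun r q x)%R, (x + dfun r q x)%R])
     ((r t `^ conj_exp p)^-1)%:E)%E.

Definition Ap r q p : \bar R := ereal_sup (range (Apx r q p)).

Definition Gintegrand r q f x (t : R) : R :=
  (r t)^-1 * expR (- \int[mu]_(s in `[x, t]) (q s / r s)) * f t.

Definition G r q f x : R := \int[mu]_(t in `[x, +oo[) Gintegrand r q f x t.

(* Integrability is required because [Rintegral] is total. *)
Definition G_bound r q p (C : R) : Prop :=
  0 <= C /\
  forall f, f \in Lfun mu p%:E ->
    [/\ forall x, mu.-integrable `[x, +oo[ (EFin \o Gintegrand r q f x),
        G r q f \in Lfun mu p%:E &
        ('N[mu]_(p%:E)[EFin \o G r q f] <=
           C%:E * 'N[mu]_(p%:E)[EFin \o f])%E].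

Definition G_bounded r q p : Prop := exists C : R, G_bound r q p C.

(* The operator norm is +oo when [G] is not a bounded operator. *)
Definition G_opnorm r q p : \bar R :=
  ereal_inf [set C%:E | C in G_bound r q p].

End Definitions.

(* Main.v *)
Require Import Defs.
From mathcomp Require Import all_boot all_order all_algebra.
From mathcomp Require Import all_classical all_reals all_analysis.
From mathcomp Require Import measurable_realfun ring lra.

Set Implicit Arguments.
Unset Strict Implicit.
Unset Printing Implicit Defensive.
Import Order.TTheory GRing.Theory Num.Theory.
Import numFieldNormedType.Exports.

Local Open Scope classical_set_scope.
Local Open Scope ring_scope.

(** Let Q be a primitive of q/r, let u = e^Q be the solution of the homogeneous
    equation and v = 1/(r u).  Then (Gf)(x) = u(x) * int_x^oo v f, and with
    U(x) = int_-oo^x u^p and V(x) = int_x^oo v^p' one has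
    M_p(x) = U(x)^(1/p) V(x)^(1/p') ([Mpx_tails]): the first part of the
    criterion is Muckenhoupt's condition for the weighted Hardy operator G.

    Norm of G.  For the upper bound ([weighted_hardy]) the factor V^(1/(p p'))
    is inserted in Hoelder's inequality and the two integrals are exchanged by
    Tonelli; the condition turns powers of V into powers of U and conversely, so
    that both inner integrals are integrals of exact derivatives, which yields
    the constant p^(1/p) p'^(1/p').  The lower bound ([Mpx_le_G_bound]) comes
    from the functions equal to v^(p'-1) on [x, b] and to 0 elsewhere.

    Solutions.  If y is a solution, then y/u + int_0 v f is absolutely continuous
    with derivative 0 almost everywhere, hence constant
    ([abs_continuous_derive0], [solution_constant]).  As u >= 1 on the right
    half-line, y/u tends to 0 at +oo, and so y = Gf ([solution_eq_G]).
    Uniqueness is thus automatic, and the problem is correctly solvable if and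
    only if G is bounded on L_p and every Gf vanishes at both ends.  If M_p is
    finite then so is U, which excludes that u^p is bounded below near -oo;
    this is condition 2 ([S1_of_lower_tail]).

    Decay.  Let W(x) = u(x)^p' V(x), the p'-th power of the norm of the
    functional f |-> (Gf)(x).  If W is bounded, Hoelder's inequality shows that
    every Gf vanishes at +oo, and at -oo as well because u does ([G_cvgy],
    [G_cvgNy]).  Conversely, if W(x_n) grows geometrically, the extremal
    functions of the functionals f |-> (Gf)(x_n) can be condensed into a single
    f in L_p with Gf unbounded ([upper_tail_bounded_of_G]); since the kernel is
    positive, nothing cancels.  Finally W is bounded if and only if A_p' is.  The
    interval of radius d(x) about x has q/r-mass 2, so that the exponential in
    W(x - d(x)) is at least e^(-2p') on it ([Ap_bounded_of_upper_tail]).  In the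
    other direction, [x, oo) is cut into pieces of mass 1, each contained in one of
    the intervals used for A_p', and their contributions to W(x) form a geometric
    series ([upper_tail_bounded_of_Ap]). *)

(** * Integrals over half-lines *)

Section integral_on_half_lines.
Context {R : realType}.
Local Notation mu := (@lebesgue_measure R).
Implicit Types (f : R -> R) (a b : R).

Lemma ge0_integral_itvcy_le f a (K : \bar R) :
  measurable_fun setT f -> (forall x, 0 <= f x) ->
  (forall b, a <= b -> (\int[mu]_(x in `[a, b]) (f x)%:E <= K)%E) ->
  (\int[mu]_(x in `[a, +oo[) (f x)%:E <= K)%E.
Proof.
move=> mf f0 fK.
pose F (n : nat) : set R := `[a, a + n%:R]%classic.
have UF : \bigcup_n F n = `[a, +oo[%classic.
  apply/seteqP; split=> [x [n _]|x] /=; rewrite !in_itv/= ?andbT.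
    by move=> /andP[].
  move=> ax; exists (Num.truncn (x - a)).+1 => //; rewrite /F /= in_itv/= ax/=.
  by rewrite -lerBlDl ltW// truncnS_gt.
rewrite -UF.
have cv := @ge0_nondecreasing_set_cvg_integral _ (measurableTypeR R) R F (EFin \o f) mu.
apply: (cvge_to_le (cv _ _ _ _)) => //=.
- apply/nondecreasing_seqP => n; rewrite subsetEset; apply: subset_itvl.
  by rewrite bnd_simp lerD2l ler_nat.
- by move=> n; exact: measurable_itv.
- by move=> n; apply/measurable_EFinP; exact: measurable_funS mf.
- by move=> n x _; rewrite lee_fin.
- by apply: nearW => n; apply: fK; rewrite lerDl.
Qed.

Lemma ge0_integral_itvNyc_le f b (K : \bar R) :
  measurable_fun setT f -> (forall x, 0 <= f x) ->
  (forall a, a <= b -> (\int[mu]_(x in `[a, b]) (f x)%:E <= K)%E) ->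
  (\int[mu]_(x in `]-oo, b]) (f x)%:E <= K)%E.
Proof.
move=> mf f0 fK.
pose F (n : nat) : set R := `[b - n%:R, b]%classic.
have UF : \bigcup_n F n = `]-oo, b]%classic.
  apply/seteqP; split=> [x [n _]|x] /=; rewrite !in_itv/= ?andbT.
    by move=> /andP[].
  move=> xb; exists (Num.truncn (b - x)).+1 => //; rewrite /F /= in_itv/= xb andbT.
  by rewrite lerBlDr -lerBlDl ltW// truncnS_gt.
rewrite -UF.
have cv := @ge0_nondecreasing_set_cvg_integral _ (measurableTypeR R) R F (EFin \o f) mu.
apply: (cvge_to_le (cv _ _ _ _)) => //=.
- apply/nondecreasing_seqP => n; rewrite subsetEset; apply: subset_itvr.
  by rewrite bnd_simp lerD2l lerN2 ler_nat.
- by move=> n; exact: measurable_itv.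
- by move=> n; apply/measurable_EFinP; exact: measurable_funS mf.
- by move=> n x _; rewrite lee_fin.
- by apply: nearW => n; apply: fK; rewrite gerBl.
Qed.

End integral_on_half_lines.

(** * Primitives of locally integrable functions *)

Section primitive.
Context {R : realType}.
Local Notation mu := (@lebesgue_measure R).
Local Notation locint := (locally_integrable [set: R]).
Implicit Types (f g c : R -> R) (a b x : R).

(** For [x < 0] the first interval is empty, so that this is the oriented
    integral from 0 to [x]. *)
Definition prim g x : R :=
  \int[mu]_(t in `[0, x]) g t - \int[mu]_(t in `[x, 0]) g t.

Lemma locint_measurable g : locint g -> measurable_fun setT g.
Proof. by case. Qed.

Lemma locint_itv g a b : locint g -> mu.-integrable `[a, b] (EFin \o g).
Proof.
move=> [mg _ ig]; apply/integrableP; split.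
  by apply/measurable_EFinP; exact: measurable_funS mg.
by apply: ig => //; exact: segment_compact.
Qed.

Lemma locintP g : measurable_fun setT g ->
  (forall a b, mu.-integrable `[a, b] (EFin \o g)) -> locint g.
Proof.
move=> mg ig; split=> // [|K _ cK]; first exact: openT.
have [M [_ KM]] := compact_bounded cK.
have {}KM : K `<=` `[- (M + 1), M + 1].
  move=> x Kx /=; rewrite in_itv/= -ler_norml.
  by apply: (KM (M + 1)) => //; rewrite ltrDl.
have /integrableP[_] := ig (- (M + 1)) (M + 1).
apply: le_lt_trans; apply: ge0_subset_integral => //.
- exact: compact_measurable.
- apply/measurable_EFinP/measurableT_comp => //.
  exact: measurable_funS mg.
Qed.

Lemma continuous_locint c : continuous c -> locint c.
Proof.
move=> cc; apply: locintP => [|a b]; first exact: continuous_measurable_fun.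
apply: continuous_compact_integrable; first exact: segment_compact.
exact: continuous_subspaceT.
Qed.

Lemma locintM c g : continuous c -> locint g -> locint (fun x => c x * g x).
Proof.
move=> cc ig; have mc := continuous_measurable_fun cc.
apply: locintP => [|a b]; first exact: (measurable_funM mc (locint_measurable ig)).
have -> : EFin \o (fun x => c x * g x) = ((EFin \o c) \* (EFin \o g))%E.
  by apply/funext => x /=.
apply: integrableMr => //; first exact: measurable_funS mc.
  have /compact_bounded[M [_ mrt]] :
      compact (c @` `[a, b]).
    apply: continuous_compact; last exact: segment_compact.
    exact: continuous_subspaceT.
  by exists M; split; rewrite ?num_real // => y My x abx; apply: mrt => //; exists x.
exact: locint_itv.
Qed.

Lemma locint_norm g : locint g -> locint (fun x => `|g x|).
Proof.
move=> ig; apply: locintP => [|a b].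
  exact: measurableT_comp (locint_measurable ig).
exact: (integrable_norm (locint_itv a b ig)).
Qed.

Lemma Rintegral_chasles g a b (c : R) : locint g -> a <= b -> b <= c ->
  \int[mu]_(t in `[a, c]) g t =
  \int[mu]_(t in `[a, b]) g t + \int[mu]_(t in `[b, c]) g t.
Proof.
move=> ig ab bc.
have := @Rintegral_itvB _ g (BLeft a) (BRight c) b (locint_itv a c ig).
rewrite !bnd_simp => /(_ ab bc).
rewrite Rintegral_itv_obnd_cbnd; last first.
  by apply: (integrableS _ _ _ (locint_itv b c ig)) => //; exact: subset_itv_oc_cc.
by move=> <-; rewrite addrC subrK.
Qed.

Lemma primB g a b : locint g -> a <= b ->
  \int[mu]_(t in `[a, b]) g t = prim g b - prim g a.
Proof.
move=> ig ab; rewrite /prim.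
have I0 x y : y <= x -> \int[mu]_(t in `[x, y]) g t = 0.
  rewrite le_eqVlt => /predU1P[->|yx].
    by rewrite set_itv1 Rintegral_set1.
  by rewrite set_itv_ge ?bnd_simp -?ltNge// Rintegral_set0.
have [a0|/ltW a0] := leP 0 a.
  have b0 := le_trans a0 ab.
  rewrite (I0 b 0)// (I0 a 0)// (@Rintegral_chasles g 0 a b)//; ring.
have [b0|/ltW b0] := leP 0 b.
  rewrite (I0 b 0)// (I0 0 a)// (@Rintegral_chasles g a 0 b)//; ring.
rewrite (I0 0 b)// (I0 0 a)// (@Rintegral_chasles g a b 0)//; ring.
Qed.

Lemma prim_le g a b : locint g -> (forall x, 0 <= g x) -> a <= b ->
  prim g a <= prim g b.
Proof. by move=> ig g0 ab; rewrite -subr_ge0 -primB// Rintegral_ge0. Qed.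

Lemma abs_continuous_on_continuous (y : R -> R) :
  (forall a b, a <= b -> abs_continuous_on a b y) -> continuous y.
Proof.
move=> acy x; apply/cvgrPdist_lt => e e0.
have [|d d0 yd] := acy (x - 1) (x + 1) _ e e0; first by lra.
have h u v : x - 1 <= u -> u <= v -> v <= x + 1 -> v - u < d ->
    `|y v - y u| < e.
  move=> xu uv vx vud.
  have := yd 1%N (fun=> u) (fun=> v).
  rewrite !big_ord_recl !big_ord0 !addr0; apply => //.
  by move=> i j _ _ _; rewrite !ord1.
near=> t.
have tx : `|x - t| < d by near: t; exact: cvgr_dist_lt.
have t1 : `|x - t| < 1 by near: t; exact: cvgr_dist_lt.
move: tx t1 => /ltr_normlP[xt1 xt2] /ltr_normlP[xt3 xt4].
have [xt|/ltW xt] := leP t x; first by apply: h; lra.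
by rewrite distrC; apply: h; lra.
Unshelve. all: by end_near. Qed.

(** Disjoint intervals of small total length form a set of small measure, on
    which the integral of an integrable function is small. *)
Lemma prim_abs_continuous g a b : locint g -> a <= b ->
  abs_continuous_on a b (prim g).
Proof.
move=> ig ab e e0.
have iab : mu.-integrable setT (EFin \o (g \_ `[a, b])).
  by rewrite -restrict_EFin; exact: (integrable_mkcond _ _).1 (locint_itv a b ig).
have [d [d0 gd]] := integral_normr_continuous iab e0.
exists d => // n u v uv tuv suv.
pose E : set R := \big[setU/set0]_(i < n) `]u i, v i[%classic.
have mE : measurable E by apply: bigsetU_measurable => i _; exact: measurable_itv.
have muE : (mu E = (\sum_(i < n) (v i - u i))%:E)%E.
  rewrite measure_bigsetU_ord//= -sumEFin; apply: eq_bigr => i _.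
  rewrite lebesgue_measure_itv/= lte_fin.
  have [_ [uvi _]] := uv i.
  case: ltgtP uvi => // [-> _]; by rewrite subrr.
have {}suv : (mu E < d%:E)%E by rewrite muE lte_fin.
have := gd E mE suv.
apply: le_lt_trans.
have inormE (A : set (measurableTypeR R)) : measurable A ->
    mu.-integrable A (EFin \o (fun x => `|(g \_ `[a, b]) x|)).
  move=> mA; apply: (@integrable_norm _ (measurableTypeR R) R mu A (g \_ `[a, b])).
  exact: (integrableS measurableT mA (@subsetT _ A) iab).
rewrite /Rintegral /E integral_bigsetU_EFin//; last 3 first.
- exact: index_enum_uniq.
- by move=> i j _ _ ij; apply: tuv.
- by apply: (measurable_int mu); exact: inormE.
rewrite -sum_fine//; last first.
  by move=> i _; apply: integrable_fin_num => //; exact: inormE.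
apply: ler_sum => i _.
have [aui [uvi vib]] := uv i.
rewrite -primB//.
apply: (le_trans (le_normr_Rintegral _ _)) => //; first exact: locint_itv.
rewrite -/(Rintegral mu `]u i, v i[ (fun x => `|(g \_ `[a, b]) x|)).
rewrite le_eqVlt; apply/orP; left; apply/eqP.
rewrite [RHS](@eq_Rintegral _ _ _ mu _ (fun x => `|g x|)); last first.
  move=> x; rewrite inE/= in_itv/= => /andP[ux xv].
  by rewrite patchE mem_set//= in_itv/= !ltW// ?(le_lt_trans aui)// (lt_le_trans xv).
rewrite /Rintegral integral_itv_bndoo//.
apply/measurable_EFinP/measurableT_comp => //.
by apply: measurable_funS (locint_measurable ig).
Qed.

Lemma prim_continuous g : locint g -> continuous (prim g).
Proof.
by move=> ig; apply: abs_continuous_on_continuous => a b; exact: prim_abs_continuous.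
Qed.

End primitive.

Section primitive_derivative.
Context {R : realType}.
Local Notation mu := (@lebesgue_measure R).
Local Notation locint := (locally_integrable [set: R]).
Implicit Types (f g : R -> R) (a b x : R).

(** Near [x] the primitives started at 0 and at [a] differ by a constant. *)
Lemma is_derive_prim g a x l : locint g -> a < x ->
  derivable (fun y => \int[mu]_(t in `[a, y]) g t) x 1 ->
  derive1 (fun y => \int[mu]_(t in `[a, y]) g t) x = l ->
  is_derive x 1 (prim g) l.
Proof.
move=> ig ax dF F'.
pose F y := \int[mu]_(t in `[a, y]) g t.
have FE : \forall y \near x, (F + cst (prim g a)) y = prim g y.
  near=> y; rewrite fctE /F /cst primB ?subrK//.
  by apply: ltW; near: y; exact: lt_nbhsr.
have dF1 : is_derive x 1 F l by apply: DeriveDef; [exact: dF|rewrite -derive1E].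
have := is_deriveD dF1 (is_derive_cst (prim g a) x 1).
by rewrite addr0; exact: near_eq_is_derive.
Unshelve. all: by end_near. Qed.

(** Lebesgue's differentiation theorem applies to the primitive started at -n,
    for the points on the right of -n; the exceptional sets are countably many. *)
Lemma is_derive_prim_ae g : locint g ->
  {ae mu, forall x, is_derive x 1 (prim g) (g x)}.
Proof.
move=> ig.
have /ae_foralln : forall n : nat, {ae mu, forall x, - n%:R < x ->
    is_derive x 1 (prim g) (g x)}.
  move=> n.
  have := @FTC1 R g (BLeft (- n%:R)) (fun y => locint_itv _ y ig) ig.
  apply: filterS; first exact: (ae_filter_ringOfSetsType mu).
  move=> x + nx => /(_ nx)[d1 d2].
  exact: is_derive_prim nx d1 d2.
apply: filterS => x H; apply: (H (Num.truncn (- x)).+1).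
by rewrite ltrNl truncnS_gt.
Qed.

Lemma is_derive_prim_continuous g x : continuous g ->
  is_derive x 1 (prim g) (g x).
Proof.
move=> cg; have ig := continuous_locint cg.
have [||||d1 d2] := @continuous_FTC1_closed R g (x - 1) x (x + 1).
- by rewrite ltrDl.
- exact: locint_itv.
- by rewrite ltrBlDr ltrDl.
- exact: cg.
by apply: is_derive_prim d1 d2 => //; rewrite ltrBlDr ltrDl.
Qed.

End primitive_derivative.

(** * Absolutely continuous functions *)

Section absolute_continuity.
Context {R : realType}.
Local Notation mu := (@lebesgue_measure R).
Implicit Types (y z phi : R -> R) (a b x : R).

(** The source of the closure properties below: in each of them the increments
    of the new function are dominated by those of its ingredients. *)
Lemma abs_continuous_on_dom a b K phi y z : 0 <= K ->
  abs_continuous_on a b y -> abs_continuous_on a b z ->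
  (forall u v, a <= u -> u <= v -> v <= b ->
    `|phi v - phi u| <= K * (`|y v - y u| + `|z v - z u|)) ->
  abs_continuous_on a b phi.
Proof.
move=> K0 acy acz H e e0.
have k0 : 0 < e / (2 * (K + 1)) by rewrite divr_gt0//; lra.
have [d1 d10 yd] := acy _ k0; have [d2 d20 zd] := acz _ k0.
exists (Num.min d1 d2); first by rewrite lt_min d10.
move=> n u v uv tuv; rewrite lt_min => /andP[s1 s2].
have {}yd := yd n u v uv tuv s1; have {}zd := zd n u v uv tuv s2.
apply: (@le_lt_trans _ _ (K * (\sum_(i < n) `|y (v i) - y (u i)| +
    \sum_(i < n) `|z (v i) - z (u i)|))).
  rewrite -big_split/= mulr_sumr; apply: ler_sum => i _.
  by have [? []] := uv i; exact: H.
have ? : 0 < K + 1 by lra.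
have -> : e = (K + 1) * (e / (2 * (K + 1)) + e / (2 * (K + 1))).
  by field; rewrite gt_eqF.
apply: (@le_lt_trans _ _ ((K + 1) * (\sum_(i < n) `|y (v i) - y (u i)| +
    \sum_(i < n) `|z (v i) - z (u i)|))).
  apply: ler_wpM2r; last by lra.
  by rewrite addr_ge0// sumr_ge0.
by rewrite ltr_pM2l// ltrD.
Qed.

Lemma continuous_bounded_itv y a b : continuous y ->
  exists2 M, 0 <= M & forall x, a <= x -> x <= b -> `|y x| <= M.
Proof.
move=> cy.
have /compact_bounded[M [_ mrt]] : compact (y @` `[a, b]).
  apply: continuous_compact; last exact: segment_compact.
  exact: continuous_subspaceT.
exists (`|M| + 1) => [|x ax xb]; first by rewrite addr_ge0.
apply: (mrt (`|M| + 1)); first by rewrite (le_lt_trans (ler_norm M))// ltrDl.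
by exists x => //=; rewrite in_itv/= ax.
Qed.

Definition abs_continuous y := forall a b, a <= b -> abs_continuous_on a b y.

Lemma abs_continuousM y z : abs_continuous y -> abs_continuous z ->
  abs_continuous (fun x => y x * z x).
Proof.
move=> acy acz a b ab.
have [M M0 yM] := continuous_bounded_itv a b (abs_continuous_on_continuous acy).
have [N N0 zN] := continuous_bounded_itv a b (abs_continuous_on_continuous acz).
apply: (@abs_continuous_on_dom _ _ (M + N) _ _ _ _ (acy a b ab) (acz a b ab)).
  by rewrite addr_ge0.
move=> u v au uv vb.
have -> : y v * z v - y u * z u = (y v - y u) * z v + y u * (z v - z u) by ring.
apply: (le_trans (ler_normD _ _)); rewrite !normrM.
have := zN v (le_trans au uv) vb; have := yM u au (le_trans uv vb).
have := normr_ge0 (y v - y u); have := normr_ge0 (z v - z u).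
have := normr_ge0 (y u); have := normr_ge0 (z v).
set p1 := `|y v - y u|; set p2 := `|z v - z u|; move: `|z v| `|y u| => s t.
nra.
Qed.

Lemma abs_continuousD y z : abs_continuous y -> abs_continuous z ->
  abs_continuous (fun x => y x + z x).
Proof.
move=> acy acz a b ab.
apply: (@abs_continuous_on_dom _ _ 1 _ _ _ _ (acy a b ab) (acz a b ab)) => //.
move=> u v _ _ _; rewrite mul1r.
by rewrite [X in `|X|](_ : _ = (y v - y u) + (z v - z u)) ?ler_normD//; ring.
Qed.

Lemma abs_continuous_cst (c : R) : abs_continuous (fun=> c).
Proof.
move=> a b ab e e0; exists 1 => // n u v _ _ _.
by rewrite big1// => i _; rewrite subrr normr0.
Qed.

Lemma abs_continuousN y : abs_continuous y -> abs_continuous (fun x => - y x).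
Proof.
move=> acy.
have := abs_continuousM (abs_continuous_cst (-1)) acy.
by under eq_fun do rewrite mulN1r.
Qed.

Lemma expR_lip (s t : R) : t <= s -> expR s - expR t <= expR s * (s - t).
Proof.
move=> ts; have -> : expR s - expR t = expR s * (1 - expR (t - s)).
  by rewrite mulrBr mulr1 -expRD (addrC s) subrK.
by rewrite ler_pM2l ?expR_gt0//; have := expR_ge1Dx (t - s); lra.
Qed.

Lemma abs_continuous_expR y : abs_continuous y ->
  abs_continuous (fun x => expR (y x)).
Proof.
move=> acy a b ab.
have [M M0 yM] := continuous_bounded_itv a b (abs_continuous_on_continuous acy).
apply: (@abs_continuous_on_dom _ _ (expR M) _ _ _ _ (acy a b ab) (acy a b ab)).
  exact: expR_ge0.
move=> u v au uv vb.
have h s t : `|s| <= M -> t <= s ->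
    `|expR s - expR t| <= expR M * (`|s - t| + `|s - t|).
  move=> sM ts; rewrite ger0_norm ?subr_ge0 ?ler_expR//.
  apply: (le_trans (expR_lip ts)).
  have := ger0_norm (x := s - t); rewrite subr_ge0 => ->//.
  have ? : expR s <= expR M by rewrite ler_expR (le_trans (ler_norm _)).
  have := expR_gt0 M; nra.
have [uv'|/ltW uv'] := leP (y u) (y v); first by apply: h => //; apply: yM => //; lra.
rewrite distrC (distrC (y v)); apply: h => //; apply: yM => //; lra.
Qed.

End absolute_continuity.

(** * Absolutely continuous functions with zero derivative *)

Section zero_derivative.
Context {R : realType}.
Local Notation mu := (@lebesgue_measure R).
Implicit Types (phi : R -> R) (a b c x e : R).

Lemma is_derive0_near phi c e : is_derive c 1 phi 0 -> 0 < e ->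
  exists2 g, 0 < g & forall x, `|x - c| < g -> `|phi x - phi c| <= e * `|x - c|.
Proof.
move=> [dphi D0] e0.
have : (fun h => h^-1 *: ((phi \o shift c) (h *: 1) - phi c)) @ 0^' --> (0 : R).
  by rewrite -[X in _ --> X]D0; exact: dphi.
move=> /cvgrPdist_le/(_ _ e0) [g /= g0 gphi].
exists g => // x xg.
have [->|xc] := eqVneq x c; first by rewrite !subrr normr0 mulr0.
have := gphi (x - c); rewrite /= sub0r normrN => /(_ xg).
rewrite subr_eq0 => /(_ xc).
rewrite sub0r normrN normrM normfV scaler1 subrK.
by rewrite ler_pdivrMl ?normr_gt0 ?subr_eq0// mulrC.
Qed.

Lemma open_ball_itv (U : set R) c : open U -> U c ->
  exists2 g, 0 < g & forall x, `|x - c| < g -> U x.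
Proof.
move=> oU Uc; have /nbhs_ballP[g /= g0 gU] := open_nbhs_nbhs (conj oU Uc).
by exists g => // x xc; apply: gU; rewrite -ball_normE /= distrC.
Qed.

(** The exceptional set has measure 0 and Lebesgue measure is outer regular. *)
Lemma negligible_open_cover (P : set R) e : {ae mu, forall x, P x} -> 0 < e ->
  exists U : set R, [/\ open U, (mu U < e%:E)%E & forall x, ~ U x -> P x].
Proof.
move=> [A [mA A0 PA]] e0.
have Ay : (mu A < +oo)%E by rewrite A0.
have [U [oU AU Ue]] := lebesgue_regularity_outer mA Ay e0.
exists U; split => //.
  have mU : measurable (U : set (measurableTypeR R)) by exact: open_measurable.
  have mUA : measurable (U `\` A : set (measurableTypeR R)).
    exact: measurableD mU mA.
  have -> : (mu U = mu (U `\` A))%E; last exact: Ue.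
  rewrite -[in LHS](setDUK AU).
  apply: etrans (measureU _ mA mUA _) _; first by rewrite setDIK.
  by rewrite [X in (X + _)%E = _]A0 add0e.
by move=> x nUx; apply: contrapT => nPx; apply/nUx/AU/PA.
Qed.

(** Cover the exceptional null set by an open set [U] of measure less than the
    [d] that absolute continuity provides for [e].  Move from [a] towards [b]:
    around a point outside [U] the function varies at slope at most [e], and
    around a point of [U] a small interval inside [U] can be crossed, whose
    increment is recorded in a list.  A supremum argument shows that [b] is
    reached; the recorded intervals are disjoint and contained in [U], so that
    their increments add up to less than [e]. *)
Lemma abs_continuous_derive0_le a b phi e : a <= b -> abs_continuous_on a b phi ->
  {ae mu, forall x, is_derive x 1 phi 0} -> 0 < e ->
  `|phi b - phi a| <= e * (b - a) + e.
Proof.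
move=> ab acphi phi0 e0.
have [d d0 dphi] := acphi e e0.
have [U [oU Ud phiU]] := negligible_open_cover phi0 d0.
(* The recorded intervals: contained in [a, x] and in U, in increasing order. *)
pose chain x (s : seq (R * R)) := [/\
  forall p, p \in s -> [/\ a <= p.1, p.1 <= p.2, p.2 <= x &
                          `]p.1, p.2[%classic `<=` U] &
  pairwise (fun p q : R * R => p.2 <= q.1) s].
pose P x := exists2 s, chain x s &
  `|phi x - phi a| <= e * (x - a) + \sum_(p <- s) `|phi p.2 - phi p.1|.
(* P passes from any point just before c to any point just after c. *)
have step c : exists2 g, 0 < g & forall x y, a <= x -> c - g < x -> x <= c ->
    c <= y -> y < c + g -> P x -> P y.
  have [Uc|nUc] := pselect (U c).
    have [g g0 gU] := open_ball_itv oU Uc.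
    exists g => // x y ax gx xc cy yg [s [sU spw] xs].
    exists (rcons s (x, y)).
      split.
        move=> p; rewrite mem_rcons inE => /predU1P[->|ps] /=.
          split => //; first lra.
          move=> z /=; rewrite in_itv/= => /andP[xz zy]; apply: gU.
          by rewrite ltr_norml; apply/andP; split; lra.
        have [? ? ? ?] := sU p ps; split => //; lra.
      rewrite pairwise_rcons spw andbT; apply/allP => p ps /=.
      by have [] := sU p ps.
    rewrite -cats1 big_cat/= big_seq1/=.
    have -> : phi y - phi a = (phi x - phi a) + (phi y - phi x) by ring.
    rewrite (le_trans (ler_normD _ _))// addrA lerD2r (le_trans xs)// lerD2r.
    by rewrite ler_pM2l//; lra.
  have [g g0 gphi] := is_derive0_near (phiU c nUc) e0.
  exists g => // x y ax gx xc cy yg [s [sU spw] xs].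
  exists s; first by split=> // p ps; have [? ? ? ?] := sU p ps; split => //; lra.
  have h1 : `|phi x - phi c| <= e * `|x - c|.
    by apply: gphi; rewrite ltr_norml; apply/andP; split; lra.
  have h2 : `|phi y - phi c| <= e * `|y - c|.
    by apply: gphi; rewrite ltr_norml; apply/andP; split; lra.
  have -> : phi y - phi a = (phi x - phi a) + ((phi y - phi c) - (phi x - phi c)).
    by ring.
  rewrite (le_trans (ler_normD _ _))//.
  have := ler_normB (phi y - phi c) (phi x - phi c).
  rewrite (ger0_norm (x := y - c)) ?subr_ge0// in h2.
  rewrite (ler0_norm (x := x - c)) ?subr_le0// in h1.
  set N1 := `|phi x - phi a| in xs *; set N2 := `|phi x - phi c| in h1 *.
  set N3 := `|phi y - phi c| in h2 *; set N4 := `| _ - _|.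
  lra.
pose S := [set x | [/\ a <= x, x <= b & P x]].
have Sa : S a.
  by split=> //; exists [::] => //; rewrite !subrr normr0 mulr0 big_nil addr0.
have hS : has_sup S by split; [exists a|exists b => x []].
set c := sup S.
have ac : a <= c by exact: (ub_le_sup hS.2).
have cb : c <= b by apply: ge_sup => [|x []//]; exists a.
have [g g0 gP] := step c.
have [x [ax xb Px] cx] := sup_adherent g0 hS.
have xc : x <= c by apply: (ub_le_sup hS.2).
have Pb : P b.
  have [bc|cltb] := leP b c.
    by apply: (gP x b) => //; lra.
  pose y := Num.min b (c + g / 2).
  have yb : y <= b by rewrite ge_min lexx.
  have yc : y <= c + g / 2 by rewrite ge_min lexx orbT.
  have cy : c < y by rewrite lt_min cltb/=; lra.
  have Sy : S y by split => //; [lra|apply: (gP x y) => //; lra].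
  by have := ub_le_sup hS.2 Sy; rewrite -/c leNgt cy.
have [s [sU spw] sb] := Pb.
apply: (le_trans sb); rewrite lerD2l ltW//.
pose u (i : 'I_(size s)) := (nth (0, 0) s i).1.
pose v (i : 'I_(size s)) := (nth (0, 0) s i).2.
have suv (i : 'I_(size s)) := sU _ (mem_nth (0, 0) (ltn_ord i)).
rewrite (big_nth (0, 0)) big_mkord.
have tuv : trivIset [set: 'I_(size s)] (fun i => `]u i, v i[%classic).
  have h (i j : 'I_(size s)) z : (i < j)%N -> u i < z < v i -> u j < z < v j -> False.
    move=> ij /andP[uz zv] /andP[uz' zv'].
    have /(pairwiseP (0, 0))/(_ i j)/= := spw.
    rewrite !inE !ltn_ord => /(_ isT isT ij).
    rewrite -/(u j) -/(v i); lra.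
  move=> i j _ _ [z [/=]]; rewrite !in_itv/= => zi zj.
  apply: val_inj => /=; case: (ltngtP i j) => // ij.
    by case: (h i j z).
  by case: (h j i z).
have := dphi _ u v; apply => //.
  by move=> i; have [? ? ? _] := suv i.
rewrite -lte_fin; apply: le_lt_trans Ud.
have -> : ((\sum_(i < size s) (v i - u i))%:E =
    mu (\big[setU/set0]_(i < size s) `]u i, v i[%classic))%E.
  rewrite measure_bigsetU_ord//= -sumEFin; apply: eq_bigr => i _.
  rewrite lebesgue_measure_itv/= lte_fin.
  have [_ uvi _ _] := suv i; rewrite -/(u i) -/(v i) in uvi.
  case: ltgtP uvi => // [-> _]; by rewrite subrr.
apply: le_measure.
- rewrite inE; apply: bigsetU_measurable => i _; exact: measurable_itv.
- by rewrite inE; exact: open_measurable.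
- by move=> z; rewrite -bigcup_seq => -[i _]; have [_ _ _] := suv i; apply.
Qed.

Lemma abs_continuous_derive0 phi : abs_continuous phi ->
  {ae mu, forall x, is_derive x 1 phi 0} -> forall a b, phi a = phi b.
Proof.
move=> acphi phi0 a b.
wlog ab : a b / a <= b.
  by move=> H; have [/H//|/ltW/H] := leP a b.
apply/esym/eqP; rewrite -subr_eq0 -normr_le0.
apply/ler_addgt0Pr => e e0; rewrite add0r.
have k0 : 0 < e / (b - a + 1) by rewrite divr_gt0//; lra.
apply: (le_trans (abs_continuous_derive0_le ab (acphi a b ab) phi0 k0)).
suff -> : e / (b - a + 1) * (b - a) + e / (b - a + 1) = e by [].
field; rewrite gt_eqF//; lra.
Qed.

End zero_derivative.

(** * Integrals with a variable end point *)

Section half_line_primitives.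
Context {R : realType}.
Local Notation mu := (@lebesgue_measure R).
Local Notation locint := (locally_integrable [set: R]).
Implicit Types (f g : R -> R) (a b x : R).

Lemma prim0 g : prim g 0 = 0.
Proof. by rewrite /prim subrr. Qed.

Lemma Rintegral_itvNyc_prim g x : locint g ->
  (forall x, mu.-integrable `]-oo, x] (EFin \o g)) ->
  \int[mu]_(t in `]-oo, x]) g t = \int[mu]_(t in `]-oo, 0]) g t + prim g x.
Proof.
move=> ig iy.
have h a b : a <= b -> \int[mu]_(t in `]-oo, b]) g t =
    \int[mu]_(t in `]-oo, a]) g t + (prim g b - prim g a).
  move=> ab; have := @Rintegral_itvB _ g -oo%O (BRight b) a (iy b).
  rewrite !bnd_simp => /(_ isT ab).
  rewrite Rintegral_itv_obnd_cbnd; last first.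
    by apply: (integrableS _ _ _ (locint_itv a b ig)) => //; exact: subset_itv_oc_cc.
  by rewrite primB// => <-; ring.
have [x0|/ltW x0] := leP 0 x; first by rewrite (h 0 x)// prim0 subr0.
by rewrite (h x 0)// prim0; ring.
Qed.

Lemma Rintegral_itvcy_prim g x : locint g ->
  (forall x, mu.-integrable `[x, +oo[ (EFin \o g)) ->
  \int[mu]_(t in `[x, +oo[) g t = \int[mu]_(t in `[0, +oo[) g t - prim g x.
Proof.
move=> ig iy.
have h a b : a <= b -> \int[mu]_(t in `[a, +oo[) g t =
    \int[mu]_(t in `[b, +oo[) g t + (prim g b - prim g a).
  move=> ab; have := @Rintegral_itvB _ g (BLeft a) +oo%O b (iy a).
  rewrite !bnd_simp => /(_ ab isT).
  rewrite Rintegral_itv_obnd_cbnd; last first.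
    by apply: (integrableS _ _ _ (iy b)) => //; apply: subset_itvr; rewrite bnd_simp.
  by rewrite primB// => <-; ring.
have [x0|/ltW x0] := leP 0 x; last by rewrite (h x 0)// prim0; ring.
by rewrite (h 0 x)// prim0; ring.
Qed.

Lemma is_derive_itvNyc g x : continuous g ->
  (forall x, mu.-integrable `]-oo, x] (EFin \o g)) ->
  is_derive x 1 (fun x => \int[mu]_(t in `]-oo, x]) g t) (g x).
Proof.
move=> cg iy; have ig := continuous_locint cg.
rewrite (_ : (fun x => _) = (cst (\int[mu]_(t in `]-oo, 0]) g t) + prim g)%R).
  rewrite -[g x]add0r; apply: is_deriveD.
  exact: is_derive_prim_continuous.
by apply/funext => y; rewrite Rintegral_itvNyc_prim.
Qed.

Lemma is_derive_itvcy g x : continuous g ->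
  (forall x, mu.-integrable `[x, +oo[ (EFin \o g)) ->
  is_derive x 1 (fun x => \int[mu]_(t in `[x, +oo[) g t) (- g x).
Proof.
move=> cg iy; have ig := continuous_locint cg.
rewrite (_ : (fun x => _) = (cst (\int[mu]_(t in `[0, +oo[) g t) - prim g)%R).
  rewrite -[- g x]add0r; apply: is_deriveD.
  apply: is_deriveN; exact: is_derive_prim_continuous.
by apply/funext => y; rewrite Rintegral_itvcy_prim.
Qed.

Lemma is_derive_continuous (F f : R -> R) :
  (forall x, is_derive x 1 F (f x)) -> continuous F.
Proof.
move=> dF x; apply: differentiable_continuous; apply/derivable1_diffP; by have [] := dF x.
Qed.

Lemma FTC2_is_derive (F f : R -> R) a b : a <= b -> continuous f ->
  (forall x, is_derive x 1 F (f x)) ->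
  (\int[mu]_(x in `[a, b]) (f x)%:E = (F b - F a)%:E)%E.
Proof.
rewrite le_eqVlt => /predU1P[-> _ _|ab cf dF].
  by rewrite set_itv1 integral_set1 subrr.
have cF := is_derive_continuous dF.
rewrite (@continuous_FTC2 _ _ F)//.
- exact: continuous_subspaceT.
- split; [by move=> x _; have [] := dF x|..].
  + by apply: cvg_at_right_filter; exact: cF.
  + by apply: cvg_at_left_filter; exact: cF.
- by move=> x _; rewrite derive1E; have [_ ->] := dF x.
Qed.

Lemma integral_itv_gt0 g a b : continuous g -> (forall x, 0 < g x) -> a < b ->
  (0 < \int[mu]_(x in `[a, b]) (g x)%:E)%E.
Proof.
move=> cg g0 ab.
have [c _ gc] := EVT_min (ltW ab) (continuous_subspaceT cg).
apply: (@lt_le_trans _ _ (\int[mu]_(x in `[a, b]) (g c)%:E)%E).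
  rewrite integral_cst//= lebesgue_measure_itv/= lte_fin ab -EFinD -EFinM lte_fin.
  by rewrite mulr_gt0// subr_gt0.
apply: ge0_le_integral => //.
- by move=> x _; rewrite lee_fin ltW.
- apply/measurable_EFinP; apply: measurable_funTS; exact: continuous_measurable_fun.
Qed.

Lemma continuous_powR (w : R -> R) s : continuous w -> (forall x, 0 < w x) ->
  continuous (fun x => w x `^ s).
Proof.
move=> cw w0 x; apply: (@continuous_comp _ _ _ w (@powR R ^~ s)); first exact: cw.
apply: differentiable_continuous; apply/derivable1_diffP.
by have [] := is_derive1_powR s (w0 x).
Qed.

Lemma is_derive_powR (F : R -> R) (l s x : R) : 0 < F x -> is_derive x 1 F l ->
  is_derive x 1 (fun y => F y `^ s) (s * F x `^ (s - 1) * l).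
Proof.
move=> Fx dF.
have := @is_derive1_comp _ (@powR R ^~ s) F x _ _ (is_derive1_powR s Fx) dF.
by rewrite mulrC.
Qed.

Lemma measurable_continuous_EFin (D : set (measurableTypeR R)) (g : R -> R) :
  continuous g -> measurable_fun D (EFin \o g).
Proof.
by move=> cg; apply/measurable_EFinP; apply: measurable_funTS;
  exact: continuous_measurable_fun.
Qed.

End half_line_primitives.

Section tails.
Context {R : realType}.
Local Notation mu := (@lebesgue_measure R).
Local Notation locint := (locally_integrable [set: R]).

(** The integral of |g| over [0, oo) is the supremum of those over the [0, b]. *)
Lemma integrable_itvcy_tail (g : R -> R) : locint g ->
  (forall x, mu.-integrable `[x, +oo[ (EFin \o g)) ->
  \int[mu]_(t in `[x, +oo[) g t @[x --> +oo] --> (0 : R).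
Proof.
move=> ig iy; apply/cvgrPdist_le => e e0.
have ing := locint_norm ig.
have iny x : mu.-integrable `[x, +oo[ (EFin \o (fun t => `|g t|)).
  exact: integrable_norm (iy x).
pose K := \int[mu]_(t in `[0, +oo[) `|g t|.
have KE : (\int[mu]_(t in `[0%R, +oo[) `|g t|%:E = K%:E)%E.
  apply/esym/fineK; apply: integrable_fin_num => //; exact: (iny 0).
have [b b0 Kb] : exists2 b, 0 <= b & K - e < prim (fun t => `|g t|) b.
  apply: contrapT => nb.
  suff : K <= K - e by rewrite lerBrDr gerDl leNgt e0.
  rewrite -lee_fin -KE; apply: ge0_integral_itvcy_le => //.
    exact: (locint_measurable ing).
  move=> b b0; rewrite -[leLHS]fineK; last first.
    by apply: integrable_fin_num => //; exact: (locint_itv _ _ ing).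
  rewrite lee_fin -/(Rintegral mu _ _) primB// prim0 subr0 leNgt.
  by apply/negP => Kb; apply: nb; exists b.
near=> x.
have bx : b <= x by near: x; apply: nbhs_pinfty_ge; rewrite num_real.
rewrite sub0r normrN; apply: (le_trans (le_normr_Rintegral _ _)) => //.
rewrite (Rintegral_itvcy_prim _ ing)// -/K.
have := prim_le ing (fun t => normr_ge0 (g t)) bx.
by lra.
Unshelve. all: by end_near. Qed.

End tails.

Section bounded_functions.
Context {R : realType}.
Local Notation mu := (@lebesgue_measure R).
Local Notation locint := (locally_integrable [set: R]).

Lemma continuous_vanishing_bounded (y : R -> R) : continuous y ->
  y x @[x --> -oo] --> (0 : R) -> y x @[x --> +oo] --> (0 : R) ->
  exists K, forall x, `|y x| <= K.
Proof.
move=> cy /cvgrPdist_le/(_ _ ltr01)[a [_ ya]] /cvgrPdist_le/(_ _ ltr01)[b [_ yb]].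
have [K K0 yK] := continuous_bounded_itv a b cy.
exists (K + 1) => x.
have [xa|ax] := ltP x a.
  by have := ya x xa; rewrite /= sub0r normrN; lra.
have [bx|xb] := ltP b x.
  by have := yb x bx; rewrite /= sub0r normrN; lra.
by have := yK x ax xb; lra.
Qed.

Lemma integrable_itvNyc_tail (g : R -> R) (e : R) : locint g ->
  (forall x, 0 <= g x) -> (\int[mu]_t (g t)%:E < +oo)%E -> 0 < e ->
  exists a, forall x, x <= a -> \int[mu]_(t in `[x, a]) g t <= e.
Proof.
move=> lg g0 gy e0; have mg := locint_measurable lg.
have gD D : measurable (D : set (measurableTypeR R)) ->
    (\int[mu]_(t in D) (g t)%:E <= \int[mu]_t (g t)%:E)%E.
  move=> mD; apply: ge0_subset_integral => //; first exact/measurable_EFinP.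
  by move=> t _; rewrite lee_fin.
pose K := fine (\int[mu]_(t in `]-oo, 0%R]) (g t)%:E)%E.
have KE : (\int[mu]_(t in `]-oo, 0%R]) (g t)%:E = K%:E)%E.
  rewrite fineK// ge0_fin_numE; last by apply: integral_ge0 => t _; rewrite lee_fin.
  exact: le_lt_trans (gD _ (measurable_itv _)) gy.
have itvE x y : (\int[mu]_(t in `[x, y]) (g t)%:E = (\int[mu]_(t in `[x, y]) g t)%:E)%E.
  by rewrite fineK//; apply: integrable_fin_num => //; exact: (locint_itv _ _ lg).
have [a a0 Ka] : exists2 a, a <= 0 & K - e < \int[mu]_(t in `[a, 0]) g t.
  apply: contrapT => na.
  suff : K <= K - e by rewrite lerBrDr gerDl leNgt e0.
  rewrite -lee_fin -KE; apply: ge0_integral_itvNyc_le => // a a0.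
  by rewrite itvE lee_fin leNgt; apply/negP => Ka; apply: na; exists a.
exists a => x xa.
have : \int[mu]_(t in `[x, 0]) g t <= K.
  rewrite -lee_fin -itvE -KE; apply: ge0_subset_integral => //.
  - by apply/measurable_EFinP; exact: measurable_funTS.
  - by move=> t _; rewrite lee_fin.
  - by move=> t /=; rewrite !in_itv/= => /andP[].
by rewrite (Rintegral_chasles lg xa a0); lra.
Qed.

End bounded_functions.

(** * Conjugate exponents and Hoelder's inequality *)

Section conjugate_exponents.
Context {R : realType}.
Implicit Types p : R.

Lemma conj_exp_gt1 p : 1 < p -> 1 < conj_exp p.
Proof. by move=> p1; rewrite /conj_exp ltr_pdivlMr ?mul1r; lra. Qed.

Lemma conj_exp_inv p : 1 < p -> p^-1 + (conj_exp p)^-1 = 1.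
Proof. by move=> p1; rewrite /conj_exp; field; rewrite !gt_eqF//; lra. Qed.

Lemma powRK (x s : R) : 0 <= x -> s != 0 -> (x `^ s) `^ s^-1 = x.
Proof. by move=> x0 s0; rewrite -powRrM mulfV// powRr1. Qed.

Lemma poweRVK (x : \bar R) (s : R) : (0 <= x -> s != 0%R -> (x `^ s^-1) `^ s = x)%E.
Proof. by move=> x0 s0; rewrite -poweRrM mulVf// poweRe1. Qed.

Lemma lee_poweR (x y : \bar R) (s : R) : 0 <= s -> (0 <= x -> x <= y ->
  x `^ s <= y `^ s)%E.
Proof.
move=> s0 x0 xy; have y0 := le_trans x0 xy.
by apply: gt0_ler_poweR => //; rewrite in_itv/= ?x0 ?y0 leey.
Qed.

End conjugate_exponents.

Section hoelder_on.
Context {R : realType}.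
Local Notation mu := (@lebesgue_measure R).

Lemma hoelder_on (D : set (measurableTypeR R)) (f g : R -> R) (p q : R) :
  measurable D -> measurable_fun setT f -> measurable_fun setT g ->
  (forall x, 0 <= f x) -> (forall x, 0 <= g x) ->
  0 < p -> 0 < q -> p^-1 + q^-1 = 1 ->
  (\int[mu]_(x in D) (f x * g x)%:E <=
   (\int[mu]_(x in D) (f x `^ p)%:E) `^ p^-1 *
   (\int[mu]_(x in D) (g x `^ q)%:E) `^ q^-1)%E.
Proof.
move=> mD mf mg f0 g0 p0 q0 pq.
have mfD : measurable_fun setT (f \_ D).
  by apply: (measurable_restrictT _ mD).1; exact: measurable_funTS.
have mgD : measurable_fun setT (g \_ D).
  by apply: (measurable_restrictT _ mD).1; exact: measurable_funTS.
have fD0 x : 0 <= (f \_ D) x by rewrite patchE; case: ifP.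
have gD0 x : 0 <= (g \_ D) x by rewrite patchE; case: ifP.
have := hoelder mu mfD mgD p0 q0 pq.
rewrite Lnorm1 unlock /=.
rewrite [X in (X <= _)%E -> _](_ : _ = \int[mu]_(x in D) (f x * g x)%:E)%E; last first.
  rewrite [RHS]integral_mkcond; apply: eq_integral => x _.
  rewrite /= ger0_norm ?mulr_ge0// !patchE.
  by case: ifP => //= _; rewrite mulr0.
rewrite [X in (_ <= X `^ _ * _)%E -> _](_ : _ = \int[mu]_(x in D) (f x `^ p)%:E)%E; last first.
  rewrite [RHS]integral_mkcond; apply: eq_integral => x _.
  rewrite ger0_norm//= !patchE.
  by case: ifP => //= _; rewrite powR0// gt_eqF.
rewrite [X in (_ <= _ * X `^ _)%E -> _](_ : _ = \int[mu]_(x in D) (g x `^ q)%:E)%E.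
  exact.
rewrite [RHS]integral_mkcond; apply: eq_integral => x _.
rewrite ger0_norm//= !patchE.
by case: ifP => //= _; rewrite powR0// gt_eqF.
Qed.

End hoelder_on.

(** * A weighted Hardy inequality *)

Section weighted_hardy.
Context {R : realType}.
Local Notation mu := (@lebesgue_measure R).
Variables (p q : R) (u v : R -> R).
Hypotheses (p_gt1 : 1 < p) (q_gt1 : 1 < q) (pq : p^-1 + q^-1 = 1).
Hypotheses (u_cont : continuous u) (u_gt0 : forall x, 0 < u x).
Hypotheses (v_cont : continuous v) (v_gt0 : forall x, 0 < v x).

(** These are the two integrals of Muckenhoupt's condition for the operator
    f |-> u(x) * int_x^oo v f. *)
Definition lower_tail x : \bar R := (\int[mu]_(t in `]-oo, x]) (u t `^ p)%:E)%E.
Definition upper_tail x : \bar R := (\int[mu]_(t in `[x, +oo[) (v t `^ q)%:E)%E.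

Let p_gt0 : 0 < p. Proof. exact: lt_trans p_gt1. Qed.
Let q_gt0 : 0 < q. Proof. exact: lt_trans q_gt1. Qed.

Let up_cont : continuous (fun x => u x `^ p).
Proof. exact: continuous_powR. Qed.
Let vq_cont : continuous (fun x => v x `^ q).
Proof. exact: continuous_powR. Qed.

Lemma lower_tail_gt0 x : (0 < lower_tail x)%E.
Proof.
have xx : x - 1 < x by rewrite ltrBlDr ltrDl.
apply: lt_le_trans (integral_itv_gt0 up_cont _ xx) _.
  by move=> t; rewrite powR_gt0.
apply: ge0_subset_integral => //.
  apply/measurable_EFinP; apply: measurable_funTS.
  exact: continuous_measurable_fun.
  by move=> t _; rewrite lee_fin powR_ge0.
by move=> t /=; rewrite !in_itv/= => /andP[].
Qed.

Lemma upper_tail_gt0 x : (0 < upper_tail x)%E.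
Proof.
have xx : x < x + 1 by rewrite ltrDl.
apply: lt_le_trans (integral_itv_gt0 vq_cont _ xx) _.
  by move=> t; rewrite powR_gt0.
apply: ge0_subset_integral => //.
  apply/measurable_EFinP; apply: measurable_funTS.
  exact: continuous_measurable_fun.
  by move=> t _; rewrite lee_fin powR_ge0.
by move=> t /=; rewrite !in_itv/= => /andP[->].
Qed.

(** Both factors are positive, so that a finite product makes each of them
    finite. *)
Lemma lower_tail_fin M x :
  (lower_tail x `^ p^-1 * upper_tail x `^ q^-1 <= M%:E)%E ->
  lower_tail x \is a fin_num.
Proof.
move=> muckenhoupt; rewrite ge0_fin_numE ?ltW ?lower_tail_gt0//.
rewrite ltey; apply/eqP => Ly.
move: muckenhoupt; rewrite Ly poweRyr; last by rewrite invr_eq0 gt_eqF.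
by rewrite gt0_mulye// poweR_gt0// upper_tail_gt0.
Qed.

Lemma upper_tail_fin M x :
  (lower_tail x `^ p^-1 * upper_tail x `^ q^-1 <= M%:E)%E ->
  upper_tail x \is a fin_num.
Proof.
move=> muckenhoupt; rewrite ge0_fin_numE ?ltW ?upper_tail_gt0//.
rewrite ltey; apply/eqP => Ly.
move: muckenhoupt; rewrite Ly poweRyr; last by rewrite invr_eq0 gt_eqF.
by rewrite gt0_muley// poweR_gt0// lower_tail_gt0.
Qed.

Variables (L V : R -> R) (M : R).
Hypotheses (LE : forall x, lower_tail x = (L x)%:E).
Hypotheses (VE : forall x, upper_tail x = (V x)%:E).
Hypothesis muckenhoupt : forall x, L x `^ p^-1 * V x `^ q^-1 <= M.

Let L_gt0 x : 0 < L x.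
Proof. by have := lower_tail_gt0 x; rewrite LE lte_fin. Qed.
Let V_gt0 x : 0 < V x.
Proof. by have := upper_tail_gt0 x; rewrite VE lte_fin. Qed.
Let M_gt0 : 0 < M.
Proof. by apply: lt_le_trans (muckenhoupt 0); rewrite mulr_gt0 ?powR_gt0. Qed.

Let is_derive_L (x : R) : is_derive x 1 L (u x `^ p).
Proof.
have -> : L = fun x => \int[mu]_(t in `]-oo, x]) (u t `^ p).
  by apply/funext => y; rewrite /Rintegral -/(lower_tail y) LE.
apply: (@is_derive_itvNyc _ (fun x => u x `^ p)) => // y; apply/integrableP; split.
  apply/measurable_EFinP; apply: measurable_funTS.
  exact: continuous_measurable_fun.
under eq_integral => t _ do rewrite /= ger0_norm ?powR_ge0//.
by rewrite -/(lower_tail y) LE ltry.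
Qed.

Let is_derive_V (x : R) : is_derive x 1 V (- (v x `^ q)).
Proof.
have -> : V = fun x => \int[mu]_(t in `[x, +oo[) (v t `^ q).
  by apply/funext => y; rewrite /Rintegral -/(upper_tail y) VE.
apply: (@is_derive_itvcy _ (fun x => v x `^ q)) => // y; apply/integrableP; split.
  apply/measurable_EFinP; apply: measurable_funTS.
  exact: continuous_measurable_fun.
under eq_integral => t _ do rewrite /= ger0_norm ?powR_ge0//.
by rewrite -/(upper_tail y) VE ltry.
Qed.

Let L_cont : continuous L. Proof. exact: is_derive_continuous is_derive_L. Qed.
Let V_cont : continuous V. Proof. exact: is_derive_continuous is_derive_V. Qed.

(** The exponent is chosen so that the integrand is the derivative of
    p L^(1/p). *)
Lemma integral_up_lower_tail t :
  (\int[mu]_(x in `]-oo, t]) (u x `^ p * L x `^ (- q^-1))%:E <=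
   (p * L t `^ p^-1)%:E)%E.
Proof.
have cu : continuous (fun x => u x `^ p * L x `^ (- q^-1)).
  by move=> x; apply: cvgM; [exact: up_cont|exact: continuous_powR].
apply: ge0_integral_itvNyc_le.
- exact: continuous_measurable_fun.
- by move=> x; rewrite mulr_ge0// powR_ge0.
have dL (x : R) : is_derive x 1 (fun x => p * L x `^ p^-1) (u x `^ p * L x `^ (- q^-1)).
  have d1 := is_derive_powR p^-1 (L_gt0 x) (is_derive_L x).
  apply: is_derive_eq (is_deriveZ p d1) _.
  rewrite /GRing.scale/= (_ : p^-1 - 1 = - q^-1); last by rewrite -pq; ring.
  by rewrite !mulrA mulfV ?gt_eqF// mul1r mulrC.
move=> a at'; rewrite (FTC2_is_derive at' cu dL).
by rewrite lee_fin lerBlDr lerDl mulr_ge0 ?powR_ge0// ltW.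
Qed.

(** The integrand is the derivative of - q V^(1/q). *)
Lemma integral_vq_upper_tail x :
  (\int[mu]_(t in `[x, +oo[) (v t `^ q * V t `^ (- p^-1))%:E <=
   (q * V x `^ q^-1)%:E)%E.
Proof.
have cv : continuous (fun x => v x `^ q * V x `^ (- p^-1)).
  by move=> y; apply: cvgM; [exact: vq_cont|exact: continuous_powR].
apply: ge0_integral_itvcy_le.
- exact: continuous_measurable_fun.
- by move=> y; rewrite mulr_ge0// powR_ge0.
have dV (y : R) : is_derive y 1 (fun x => - q * V x `^ q^-1) (v y `^ q * V y `^ (- p^-1)).
  have d1 := is_derive_powR q^-1 (V_gt0 y) (is_derive_V y).
  apply: is_derive_eq (is_deriveZ (- q) d1) _.
  rewrite /GRing.scale/= (_ : q^-1 - 1 = - p^-1); last by rewrite -pq; ring.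
  by field; rewrite gt_eqF.
move=> b xb; rewrite (FTC2_is_derive xb cv dV).
rewrite lee_fin !mulNr opprK addrC lerBlDr lerDl.
by rewrite mulr_ge0 ?powR_ge0// ltW.
Qed.

Variable f : R -> R.
Hypotheses (f_meas : measurable_fun setT f) (f_ge0 : forall x, 0 <= f x).

Let vf_meas : measurable_fun setT (fun t => v t * f t).
Proof. by apply: measurable_funM => //; exact: continuous_measurable_fun. Qed.

(** Hoelder's inequality for (f V^(1/(pq))) (v V^(-1/(pq))): with this exponent
    the integral of the q-th power of the second factor is again a power of
    [V], by [integral_vq_upper_tail]. *)
Lemma upper_integral_le x :
  ((\int[mu]_(t in `[x, +oo[) (v t * f t)%:E) `^ p <=
   ((q * V x `^ q^-1) `^ (p / q))%:E *
   \int[mu]_(t in `[x, +oo[) (f t `^ p * V t `^ q^-1)%:E)%E.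
Proof.
pose h t := V t `^ (p * q)^-1.
have h_gt0 t : 0 < h t by rewrite powR_gt0.
have h_cont : continuous h by exact: continuous_powR.
have hV_cont : continuous (fun t => v t * V t `^ (- (p * q)^-1)).
  by move=> y; apply: cvgM; [exact: v_cont|exact: continuous_powR].
have E1 : (\int[mu]_(t in `[x, +oo[) (f t * h t * (v t * V t `^ (- (p * q)^-1)))%:E =
    \int[mu]_(t in `[x, +oo[) (v t * f t)%:E)%E.
  apply: eq_integral => t _; congr EFin.
  by rewrite /h powRN; field; rewrite gt_eqF// powR_gt0.
have E2 : (\int[mu]_(t in `[x, +oo[) ((f t * h t) `^ p)%:E =
    \int[mu]_(t in `[x, +oo[) (f t `^ p * V t `^ q^-1)%:E)%E.
  apply: eq_integral => t _; congr EFin.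
  rewrite powRM ?(ltW (h_gt0 t))// /h -powRrM; congr (_ * V t `^ _).
  by field; rewrite !gt_eqF.
have E3 : (\int[mu]_(t in `[x, +oo[) ((v t * V t `^ (- (p * q)^-1)) `^ q)%:E =
    \int[mu]_(t in `[x, +oo[) (v t `^ q * V t `^ (- p^-1))%:E)%E.
  apply: eq_integral => t _; congr EFin.
  rewrite powRM ?powR_ge0 ?(ltW (v_gt0 t))// -powRrM; congr (_ * V t `^ _).
  by field; rewrite !gt_eqF.
have mfh := measurable_funM f_meas (continuous_measurable_fun h_cont).
have mhV := continuous_measurable_fun hV_cont.
have fh0 t : 0 <= f t * h t by rewrite mulr_ge0// ltW.
have hV0 t : 0 <= v t * V t `^ (- (p * q)^-1) by rewrite mulr_ge0 ?powR_ge0// ltW.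
have H : (\int[mu]_(t in `[x, +oo[) (v t * f t)%:E <=
    (\int[mu]_(t in `[x, +oo[) (f t `^ p * V t `^ q^-1)%:E) `^ p^-1 *
    (q * V x `^ q^-1)%:E `^ q^-1)%E.
  rewrite -E1; apply: le_trans
    (hoelder_on (measurable_itv _) mfh mhV fh0 hV0 p_gt0 q_gt0 pq) _.
  rewrite [X in (X `^ _ * _)%E]E2; apply: lee_wpmul2l; first exact: poweR_ge0.
  rewrite [X in (X `^ _)%E]E3; apply: lee_poweR; first by rewrite invr_ge0 ltW.
  - by apply: integral_ge0 => t _; rewrite lee_fin mulr_ge0// powR_ge0.
  - exact: integral_vq_upper_tail.
have vf0 : (0 <= \int[mu]_(t in `[x, +oo[) (v t * f t)%:E)%E.
  by apply: integral_ge0 => t _; rewrite lee_fin mulr_ge0// ltW.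
have fV0 : (0 <= \int[mu]_(t in `[x, +oo[) (f t `^ p * V t `^ q^-1)%:E)%E.
  by apply: integral_ge0 => t _; rewrite lee_fin mulr_ge0// powR_ge0.
have {}H := lee_poweR (ltW p_gt0) vf0 H.
apply: (le_trans H).
rewrite poweRM ?poweR_ge0// poweRVK ?gt_eqF// muleC -poweRrM poweR_EFin.
by rewrite (mulrC q^-1).
Qed.

Lemma upper_integral_hoelder x :
  (\int[mu]_(t in `[x, +oo[) (v t * f t)%:E <=
   upper_tail x `^ q^-1 * (\int[mu]_(t in `[x, +oo[) (f t `^ p)%:E) `^ p^-1)%E.
Proof.
apply: hoelder_on => //.
- exact: continuous_measurable_fun.
- by move=> t; rewrite ltW.
- by rewrite addrC.
Qed.

Hypothesis f_fin : (\int[mu]_t (f t `^ p)%:E < +oo)%E.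

Let fp_meas : measurable_fun setT (fun t => f t `^ p).
Proof. exact: (measurableT_comp (measurable_powR p) f_meas). Qed.

Lemma upper_integral_lty x : (\int[mu]_(t in `[x, +oo[) (v t * f t)%:E < +oo)%E.
Proof.
apply: le_lt_trans (upper_integral_hoelder x) _.
rewrite lte_mul_pinfty ?poweR_ge0//; first by rewrite VE poweR_EFin.
apply: poweR_lty; apply: le_lt_trans f_fin.
apply: ge0_subset_integral => //; first exact/measurable_EFinP.
by move=> t _; rewrite lee_fin powR_ge0.
Qed.

Variable C : R -> R.
Hypothesis CE : forall x, (\int[mu]_(t in `[x, +oo[) (v t * f t)%:E = (C x)%:E)%E.

Let integral_itvcy_if x (g : R -> R) :
  (\int[mu]_(t in `[x, +oo[) (g t)%:E =
   \int[mu]_t ((if x <= t then g t else 0)%R)%:E)%E.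
Proof.
rewrite integral_mkcond; apply: eq_integral => t _; rewrite patchE.
by rewrite mem_setE in_itv/= andbT; case: ifP.
Qed.

Let integral_itvNyc_if t (g : R -> R) :
  (\int[mu]_(x in `]-oo, t]) (g x)%:E =
   \int[mu]_x ((if x <= t then g x else 0)%R)%:E)%E.
Proof.
rewrite integral_mkcond; apply: eq_integral => x _; rewrite patchE.
by rewrite mem_setE in_itv/=; case: ifP.
Qed.

Let measurable_le_kernel (a b : R -> R) : measurable_fun setT a -> measurable_fun setT b ->
  measurable_fun setT (fun z : measurableTypeR R * measurableTypeR R =>
    (if (z.1 : R) <= z.2 then a z.1 * b z.2 else 0)%:E).
Proof.
move=> ma mb; apply/measurable_EFinP; apply: measurable_fun_ifT => //.
  exact: (measurable_fun_ler measurable_fst measurable_snd).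
apply: measurable_funM.
  exact: (measurableT_comp ma measurable_fst).
exact: (measurableT_comp mb measurable_snd).
Qed.

Let C_meas : measurable_fun setT C.
Proof.
have m1 : measurable_fun setT (cst 1 : R -> R) by exact: measurable_cst.
have mk := measurable_le_kernel m1 vf_meas.
have mF := measurable_fun_fubini_tonelli_F (m2 := mu) _ mk.
have -> : C = fine \o fubini_F mu (fun z : measurableTypeR R * measurableTypeR R =>
    (if (z.1 : R) <= z.2 then cst 1 z.1 * (v z.2 * f z.2) else 0)%:E).
  apply/funext => x; rewrite /fubini_F/= -[LHS]/(fine (C x)%:E) -CE integral_itvcy_if.
  by under [in RHS]eq_integral do rewrite mul1r.
apply: (measurableT_comp (fine_measurable measurableT)).
apply: mF => z; case: ifP => // _.
by rewrite lee_fin !mulr_ge0// ltW.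
Qed.

(** Muckenhoupt's condition trades the power of [V] for the power of [L] that
    [integral_up_lower_tail] can integrate against u^p. *)
Let V_bound x : (q * V x `^ q^-1) `^ (p / q) <= (q * M) `^ (p / q) * L x `^ (- q^-1).
Proof.
have -> : L x `^ (- q^-1) = (L x `^ (- p^-1)) `^ (p / q).
  by rewrite -powRrM; congr (_ `^ _); field; rewrite !gt_eqF.
have qM0 : 0 <= q * M by rewrite mulr_ge0 ?ltW.
have L0 : 0 <= L x `^ (- p^-1) by exact: powR_ge0.
have pq0 : 0 <= p / q by rewrite divr_ge0 ?ltW.
have qV0 : 0 <= q * V x `^ q^-1 by rewrite mulr_ge0 ?powR_ge0 ?ltW.
rewrite -(powRM (p / q) qM0 L0).
apply: (ge0_ler_powR pq0); rewrite ?nnegrE; [exact: qV0|exact: mulr_ge0|].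
rewrite -mulrA ler_pM2l// powRN ler_pdivlMr ?powR_gt0// mulrC.
exact: muckenhoupt.
Qed.

(** After the exchange of the integrals, f(t)^p is multiplied by
    V(t)^(1/q) * int_-oo^t u^p L^(-1/q) <= p L(t)^(1/p) V(t)^(1/q) <= p M. *)
Lemma weighted_hardy :
  (\int[mu]_x ((u x * C x) `^ p)%:E <=
   (p * q `^ (p / q) * M `^ p)%:E * \int[mu]_t (f t `^ p)%:E)%E.
Proof.
pose w x := u x `^ p * L x `^ (- q^-1).
pose g t := f t `^ p * V t `^ q^-1.
have w_cont : continuous w.
  by move=> x; apply: cvgM; [exact: up_cont|exact: continuous_powR].
have w_meas : measurable_fun setT w by exact: continuous_measurable_fun.
have w_ge0 x : 0 <= w x by rewrite mulr_ge0// powR_ge0.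
have g_meas : measurable_fun setT g.
  apply: measurable_funM => //; apply: continuous_measurable_fun.
  exact: continuous_powR.
have g_ge0 x : 0 <= g x by rewrite mulr_ge0// powR_ge0.
have C_ge0 x : 0 <= C x.
  by rewrite -lee_fin -CE; apply: integral_ge0 => t _; rewrite lee_fin mulr_ge0// ltW.
pose K (z : measurableTypeR R * measurableTypeR R) : \bar R :=
  (if (z.1 : R) <= z.2 then w z.1 * g z.2 else 0)%:E.
have K_meas : measurable_fun setT K by exact: measurable_le_kernel.
have K_ge0 z : (0 <= K z)%E by rewrite /K; case: ifP => // _; rewrite lee_fin mulr_ge0.
have KF x : (\int[mu]_t K (x, t) =
    (w x)%:E * \int[mu]_(t in `[x, +oo[) (g t)%:E)%E.
  rewrite integral_itvcy_if -ge0_integralZl_EFin//.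
  - by apply: eq_integral => t _; rewrite /K/=; case: ifP => // _; rewrite ?mule0 -?EFinM.
  - by move=> t _; rewrite lee_fin; case: ifP.
  - apply/measurable_EFinP; apply: measurable_fun_ifT => //.
    by apply: measurable_fun_ler.
have KG t : (\int[mu]_x K (x, t) =
    (g t)%:E * \int[mu]_(x in `]-oo, t]) (w x)%:E)%E.
  rewrite integral_itvNyc_if -ge0_integralZl_EFin//.
  - apply: eq_integral => x _; rewrite /K/=; case: ifP => // _; rewrite ?mule0 -?EFinM//.
    by rewrite mulrC.
  - by move=> x _; rewrite lee_fin; case: ifP.
  - apply/measurable_EFinP; apply: measurable_fun_ifT => //.
    by apply: measurable_fun_ler.
have qM0 : 0 <= (q * M) `^ (p / q) by rewrite powR_ge0.
apply: (@le_trans _ _ (((q * M) `^ (p / q))%:E * \int[mu]_x \int[mu]_t K (x, t))%E).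
  rewrite -ge0_integralZl_EFin//; last 2 first.
  - by move=> x _; apply: integral_ge0.
  - exact: (measurable_fun_fubini_tonelli_F (m2 := mu) K K_meas K_ge0).
  apply: ge0_le_integral => //.
  - by move=> x _; rewrite lee_fin powR_ge0.
  - apply/measurable_EFinP.
    apply: (measurableT_comp (measurable_powR p)).
    apply: measurable_funM => //; exact: continuous_measurable_fun.
  - apply: measurable_funeM.
    exact: (measurable_fun_fubini_tonelli_F (m2 := mu) K K_meas K_ge0).
  move=> x _; rewrite KF powRM ?(ltW (u_gt0 x))// EFinM.
  have -> : (((q * M) `^ (p / q))%:E * ((w x)%:E * \int[mu]_(t in `[x, +oo[) (g t)%:E) =
    (u x `^ p)%:E * (((q * M) `^ (p / q) * L x `^ (- q^-1))%:E *
      \int[mu]_(t in `[x, +oo[) (g t)%:E))%E.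
    by rewrite !muleA -!EFinM; congr (_%:E * _)%E; rewrite /w; ring.
  apply: lee_wpmul2l; first by rewrite lee_fin powR_ge0.
  rewrite -poweR_EFin -CE; apply: (le_trans (upper_integral_le x)).
  apply: lee_wpmul2r; last by rewrite lee_fin; exact: V_bound.
  by apply: integral_ge0 => t _; rewrite lee_fin; exact: g_ge0.
rewrite (fubini_tonelli K)//.
have -> : (p * q `^ (p / q) * M `^ p = (q * M) `^ (p / q) * (p * M)).
  have pq1 : p / q = p - 1.
    by rewrite (_ : q^-1 = 1 - p^-1) ?mulrBr ?mulr1 ?mulfV ?gt_eqF// -pq; ring.
  by rewrite powRM ?ltW// -(mulr_powRB1 (ltW M_gt0) p_gt0) pq1; ring.
rewrite EFinM -muleA; apply: lee_wpmul2l; first by rewrite lee_fin.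
rewrite -ge0_integralZl_EFin//; last 3 first.
- by move=> t _; rewrite lee_fin powR_ge0.
- exact/measurable_EFinP.
- by rewrite mulr_ge0 ?ltW.
apply: ge0_le_integral => //.
- by move=> t _; apply: integral_ge0.
- exact: (measurable_fun_fubini_tonelli_G (m1 := mu) K K_meas K_ge0).
- by apply: measurable_funeM; exact/measurable_EFinP.
move=> t _; rewrite KG.
apply: (@le_trans _ _ ((g t)%:E * (p * L t `^ p^-1)%:E)%E).
  apply: lee_wpmul2l; first by rewrite lee_fin.
  exact: integral_up_lower_tail.
rewrite -!EFinM lee_fin /g.
have := muckenhoupt t; move: (L t `^ _) (V t `^ _) (powR_ge0 (f t) p) => a b c0 ab.
rewrite [leLHS](_ : _ = f t `^ p * p * (a * b)); last by ring.
rewrite [leRHS](_ : _ = f t `^ p * p * M); last by ring.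
by apply: ler_wpM2l => //; rewrite mulr_ge0// ltW.
Qed.

End weighted_hardy.

(** * Functions in L_p *)

Section Lfun_facts.
Context {R : realType}.
Local Notation mu := (@lebesgue_measure R).
Local Notation locint := (locally_integrable [set: R]).
Implicit Types (f : R -> R) (p : R).

Lemma LnormE p f :
  ('N[mu]_(p%:E)[EFin \o f] = (\int[mu]_x (`|f x| `^ p)%:E) `^ p^-1)%E.
Proof. by rewrite unlock. Qed.

Lemma Lfun_measurable p f : f \in Lfun mu p%:E -> measurable_fun setT f.
Proof. by move=> /andP[+ _]; rewrite inE. Qed.

Lemma Lfun_lty p f : 0 < p -> f \in Lfun mu p%:E ->
  (\int[mu]_x (`|f x| `^ p)%:E < +oo)%E.
Proof.
move=> p0 /andP[_]; rewrite inE/= /finite_norm LnormE => fp.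
by apply: lty_poweRy fp; rewrite invr_eq0 gt_eqF.
Qed.

Lemma in_Lfun p f : measurable_fun setT f ->
  (\int[mu]_x (`|f x| `^ p)%:E < +oo)%E -> f \in Lfun mu p%:E.
Proof.
move=> mf fp; apply/andP; rewrite !inE/= /finite_norm LnormE; split => //.
exact: poweR_lty.
Qed.

Lemma Lfun_norm_in p f : 0 < p -> f \in Lfun mu p%:E ->
  (fun x => `|f x|) \in Lfun mu p%:E.
Proof.
move=> p0 fp; apply: in_Lfun.
  by have mf := Lfun_measurable fp; exact: measurableT_comp.
by under eq_integral do rewrite normr_id; exact: Lfun_lty.
Qed.

(** |f| <= 1 + |f|^p. *)
Lemma Lfun_locint p f : 1 < p -> f \in Lfun mu p%:E -> locint f.
Proof.
move=> p1; have p0 : 0 < p by lra.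
move=> fLp; have mf := Lfun_measurable fLp; have fp := Lfun_lty p0 fLp.
apply: locintP => // a b.
apply/integrableP; split.
  by apply/measurable_EFinP; exact: measurable_funTS.
have mfp : measurable_fun setT (fun x => `|f x| `^ p).
  apply: (measurableT_comp (measurable_powR p)); exact: measurableT_comp.
apply: (@le_lt_trans _ _ (\int[mu]_(x in `[a, b]) (1 + `|f x| `^ p)%:E)%E).
  apply: ge0_le_integral => //.
  - by apply/measurable_EFinP; apply: measurable_funTS; exact: measurableT_comp.
  - by apply/measurable_EFinP; apply: measurable_funTS; exact: measurable_funD.
  - move=> x _; rewrite /= lee_fin.
    have [f1|f1] := leP `|f x| 1; first by rewrite (le_trans f1)// lerDl powR_ge0.
    have := le1r_powR (ltW f1) (ltW p1); have := powR_ge0 `|f x| p; lra.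
under eq_integral do rewrite EFinD.
rewrite ge0_integralD//=.
- apply: lte_add_pinfty.
    by rewrite integral_cst//= lebesgue_measure_itv/=; case: ifP => _; rewrite mul1e// -EFinB ltry.
  apply: le_lt_trans fp; apply: ge0_subset_integral => //.
  exact/measurable_EFinP.
- by apply/measurable_EFinP; exact: measurable_funTS.
Qed.

Lemma expR_powR (x s : R) : expR x `^ s = expR (s * x).
Proof. by rewrite /powR gt_eqF ?expR_gt0// expRK. Qed.

Lemma invr_powR (a s : R) : 0 <= a -> a^-1 `^ s = (a `^ s)^-1.
Proof. by move=> a0; rewrite -powR_inv1// -powRrM mulN1r powRN. Qed.

End Lfun_facts.

(** * G as a weighted Hardy operator *)

Section first_order_equation.
Context {R : realType}.
Local Notation mu := (@lebesgue_measure R).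
Local Notation locint := (locally_integrable [set: R]).
Variables (r q : R -> R) (p : R).
Hypotheses (r_cont : continuous r) (r_gt0 : forall x, 0 < r x).
Hypotheses (q_loc : locint q) (q_ge0 : forall x, 0 <= q x) (p_gt1 : 1 < p).

Local Notation p' := (conj_exp p).

Definition mass_primitive (x : R) : R := prim (fun s => q s / r s) x.
(** A solution of r u' = q u. *)
Definition hom_solution x := expR (mass_primitive x).
(** The function 1/(r u): the kernel of [G] is u(x) v(t) for x <= t. *)
Definition kernel_weight x := (r x)^-1 * expR (- mass_primitive x).

Local Notation Q := mass_primitive.
Local Notation u := hom_solution.
Local Notation v := kernel_weight.

Lemma rinv_cont : continuous (fun x => (r x)^-1).
Proof. by move=> x; apply: cvgV; [rewrite gt_eqF|exact: r_cont]. Qed.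

Lemma qr_locint : locint (fun s => q s / r s).
Proof.
have := locintM rinv_cont q_loc.
by under eq_fun do rewrite mulrC.
Qed.

Lemma qr_ge0 x : 0 <= q x / r x.
Proof. by rewrite divr_ge0// ltW. Qed.

Lemma Q_cont : continuous Q. Proof. exact: prim_continuous qr_locint. Qed.

Lemma Q_le a b : a <= b -> Q a <= Q b.
Proof. by apply: prim_le; [exact: qr_locint|exact: qr_ge0]. Qed.

Lemma massE a b : a <= b -> \int[mu]_(s in `[a, b]) (q s / r s) = Q b - Q a.
Proof. by move=> ab; rewrite primB//; exact: qr_locint. Qed.

Lemma u_gt0 x : 0 < u x. Proof. exact: expR_gt0. Qed.
Lemma v_gt0 x : 0 < v x. Proof. by rewrite mulr_gt0 ?invr_gt0 ?expR_gt0. Qed.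

Lemma u_cont : continuous u.
Proof. by move=> x; apply: continuous_comp; [exact: Q_cont|exact: continuous_expR]. Qed.

Lemma v_cont : continuous v.
Proof.
move=> x; apply: cvgM; first exact: rinv_cont.
apply: (@continuous_comp _ _ _ (fun x => - Q x) expR); last exact: continuous_expR.
by apply: cvgN; exact: Q_cont.
Qed.

Let p_gt0 : 0 < p. Proof. exact: lt_trans p_gt1. Qed.
Let p'_gt1 : 1 < p'. Proof. exact: conj_exp_gt1. Qed.
Let p'_gt0 : 0 < p'. Proof. exact: lt_trans p'_gt1. Qed.
Let pp' : p^-1 + p'^-1 = 1. Proof. exact: conj_exp_inv. Qed.

Lemma u_powR s x : u x `^ s = expR (s * Q x).
Proof. exact: expR_powR. Qed.

Lemma v_powR s x : v x `^ s = (r x `^ s)^-1 * expR (- (s * Q x)).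
Proof.
have r0 := ltW (r_gt0 x).
by rewrite powRM ?expR_ge0 ?invr_ge0// invr_powR// expR_powR mulrN.
Qed.

Let vC : continuous v. Proof. exact: v_cont. Qed.
Let uC : continuous u. Proof. exact: u_cont. Qed.
Let QC : continuous Q. Proof. exact: Q_cont. Qed.
Let v0 x : 0 < v x. Proof. exact: v_gt0. Qed.
Let u0 x : 0 < u x. Proof. exact: u_gt0. Qed.
Let c_loc : locint (fun s => q s / r s). Proof. exact: qr_locint. Qed.
Let mass a b : a <= b -> \int[mu]_(s in `[a, b]) (q s / r s) = Q b - Q a.
Proof. exact: massE. Qed.
Let Qle a b : a <= b -> Q a <= Q b. Proof. exact: Q_le. Qed.
Let vpC : continuous (fun t => v t `^ p'). Proof. exact: continuous_powR. Qed.

Lemma lower_weightE t x : t <= x ->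
  expR (- p * \int[mu]_(s in `[t, x]) (q s / r s)) = (u x `^ p)^-1 * u t `^ p.
Proof.
move=> tx; have ux := u_powR p x; have ut := u_powR p t.
rewrite [X in X^-1]ux [X in _ = _ * X]ut -expRN -expRD massE//.
by congr expR; ring.
Qed.

(** The first integral of M_p(x) is [lower_tail] divided by u(x)^p and the second
    is [upper_tail] multiplied by u(x)^p', so that the powers of u(x) cancel. *)
Lemma Mpx_tails x : Mpx r q p x =
  (lower_tail p u x `^ p^-1 * upper_tail p' v x `^ p'^-1)%E.
Proof.
have cu : continuous (fun t => u t `^ p) := continuous_powR u_cont u_gt0.
have cv : continuous (fun t => v t `^ p') := continuous_powR v_cont v_gt0.
have -> : lower_tail p u x = ((u x `^ p)%:E *
    \int[mu]_(t in `]-oo, x]) (expR (- p * \int[mu]_(s in `[t, x]) (q s / r s))%R)%:E)%E.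
  rewrite [RHS](_ : _ = (u x `^ p)%:E *
    \int[mu]_(t in `]-oo, x]) ((u x `^ p)^-1 * u t `^ p)%:E)%E; last first.
    congr (_ * _)%E; apply: eq_integral => t; rewrite inE/= in_itv/= => tx.
    by rewrite lower_weightE.
  under [in RHS]eq_integral do rewrite EFinM.
  rewrite ge0_integralZl_EFin//.
  - by rewrite muleA -EFinM mulfV ?mul1e// gt_eqF// powR_gt0 ?u_gt0.
  - by move=> t _; rewrite lee_fin powR_ge0.
  - exact: measurable_continuous_EFin.
  - by rewrite invr_ge0 powR_ge0.
have -> : upper_tail p' v x = ((u x `^ (- p'))%:E *
    \int[mu]_(t in `[x, +oo[)
      ((r t `^ p')^-1 *
       expR (- p' * \int[mu]_(s in `[x, t]) (q s / r s)))%R%:E)%E.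
  rewrite [RHS](_ : _ = (u x `^ (- p'))%:E *
    \int[mu]_(t in `[x, +oo[) (u x `^ p' * v t `^ p')%:E)%E; last first.
    congr (_ * _)%E; apply: eq_integral => t; rewrite inE/= in_itv/= andbT => tx.
    rewrite (massE tx) v_powR u_powR mulrCA -expRD.
    congr (_ * expR _)%:E.
    by ring.
  under [in RHS]eq_integral do rewrite EFinM.
  rewrite ge0_integralZl_EFin//.
  - by rewrite muleA -EFinM powRN mulVf ?mul1e// gt_eqF// powR_gt0 ?u_gt0.
  - by move=> t _; rewrite lee_fin powR_ge0.
  - exact: measurable_continuous_EFin.
  - by rewrite powR_ge0.
rewrite /Mpx; set I1 := (\int[mu]_(t in `]-oo, x]) _)%E.
set I2 := (\int[mu]_(t in `[x, +oo[) _)%E.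
have I10 : (0 <= I1)%E by apply: integral_ge0 => t _; rewrite lee_fin expR_ge0.
have I20 : (0 <= I2)%E.
  by apply: integral_ge0 => t _; rewrite lee_fin mulr_ge0 ?invr_ge0 ?powR_ge0 ?expR_ge0.
rewrite !poweRM ?lee_fin ?powR_ge0// !poweR_EFin -!powRrM.
rewrite mulfV ?gt_eqF// mulNr mulfV ?gt_eqF// powRN powRr1 ?(ltW (u_gt0 x))//.
rewrite muleACA -EFinM mulfV ?mul1e//.
by rewrite gt_eqF// u_gt0.
Qed.

Lemma Q0 : Q 0 = 0.
Proof. exact: prim0. Qed.

Lemma Gintegrand_weights f x t : x <= t ->
  Gintegrand r q f x t = u x * (v t * f t).
Proof.
move=> xt; rewrite /Gintegrand massE// /hom_solution /kernel_weight opprB expRD.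
by ring.
Qed.

Lemma integrable_Gintegrand f x :
  mu.-integrable `[x, +oo[ (EFin \o (fun t => v t * f t)) ->
  mu.-integrable `[x, +oo[ (EFin \o Gintegrand r q f x).
Proof.
move=> ivf; apply: eq_integrable (integrableZl _ (u x) ivf) => // t.
by rewrite inE/= in_itv/= andbT => xt; rewrite Gintegrand_weights.
Qed.

Lemma G_weights f x : mu.-integrable `[x, +oo[ (EFin \o (fun t => v t * f t)) ->
  G r q f x = u x * \int[mu]_(t in `[x, +oo[) (v t * f t).
Proof.
move=> ivf; rewrite -RintegralZl//; apply: eq_Rintegral => t.
by rewrite inE/= in_itv/= andbT => xt; rewrite Gintegrand_weights.
Qed.

Definition weight_integrable f :=
  forall x, mu.-integrable `[x, +oo[ (EFin \o (fun t => v t * f t)).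

Lemma G_continuous f : locint f -> weight_integrable f -> continuous (G r q f).
Proof.
move=> lf ivf.
have lvf : locint (fun t => v t * f t) by exact: locintM.
have -> : G r q f = fun x =>
    u x * (\int[mu]_(t in `[0, +oo[) (v t * f t) - prim (fun t => v t * f t) x).
  by apply/funext => x; rewrite G_weights// (Rintegral_itvcy_prim _ lvf).
move=> x; apply: cvgM; first exact: uC.
by apply: cvgB; [exact: cvg_cst|exact: prim_continuous].
Qed.

(** * The norm of G *)

(** The test function f equal to v^(p'-1) on [x, b] gives equality in Hoelder's
    inequality for int_x^b v f.  With w = int_x^b v^p', one has |f|^p = v^p' on
    [x, b], hence ||f||_p = w^(1/p), and Gf = u w on (-oo, x], so that
    w U(x)^(1/p) <= C w^(1/p).  Truncating at b keeps w finite before the tails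
    are known to be; then b tends to +oo. *)
Lemma Mpx_le_G_bound C x : G_bound r q p C -> (Mpx r q p x <= C%:E)%E.
Proof.
move=> [C0 GC]; rewrite Mpx_tails//.
have upC : continuous (fun t => u t `^ p) by exact: continuous_powR.
set U := lower_tail p u x.
have U_gt0 : (0 < U)%E by exact: lower_tail_gt0.
have test b : x <= b ->
    exists2 w, (\int[mu]_(t in `[x, b]) (v t `^ p')%:E = w%:E)%E &
    (w%:E * U `^ p^-1 <= (C * w `^ p^-1)%:E)%E /\ 0 <= w.
  move=> xb; exists (\int[mu]_(t in `[x, b]) (v t `^ p')).
    by rewrite fineK// integrable_fin_num//; apply: locint_itv; exact: continuous_locint.
  set w := \int[mu]_(t in `[x, b]) (v t `^ p').
  have wE : (\int[mu]_(t in `[x, b]) (v t `^ p')%:E = w%:E)%E.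
    by rewrite fineK// integrable_fin_num//; apply: locint_itv; exact: continuous_locint.
  have w0 : 0 <= w by apply: Rintegral_ge0 => t _; exact: powR_ge0.
  split=> //.
  pose f := (fun t => v t `^ (p' - 1)) \_ `[x, b].
  have fE t : f t = if t \in `[x, b] then v t `^ (p' - 1) else 0.
    by rewrite /f patchE mem_setE.
  have f_meas : measurable_fun setT f.
    apply: (measurable_restrictT _ (measurable_itv _)).1.
    apply: measurable_funTS; apply: continuous_measurable_fun.
    exact: continuous_powR.
  have f_norm : (\int[mu]_t (`|f t| `^ p)%:E = w%:E)%E.
    rewrite -wE [RHS]integral_mkcond; apply: eq_integral => t _.
    rewrite patchE mem_setE fE; case: ifP => _; last by rewrite normr0 powR0// gt_eqF.
    rewrite ger0_norm ?powR_ge0// -powRrM; congr (_ `^ _)%:E.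
    by rewrite /conj_exp; field; rewrite gt_eqF// subr_gt0.
  have f_Lp : f \in Lfun mu p%:E by apply: in_Lfun => //; rewrite f_norm ltry.
  have vf t : v t * f t = ((fun t => v t `^ p') \_ `[x, b]) t.
    rewrite fE patchE mem_setE; case: ifP => _; last by rewrite mulr0.
    by rewrite mulr_powRB1// ltW.
  have ivf s : mu.-integrable `[s, +oo[ (EFin \o (fun t => v t * f t)).
    apply: (@integrableS _ _ _ _ setT) => //.
    rewrite (_ : (fun t => v t * f t) = (fun t => v t `^ p') \_ `[x, b]); last exact/funext.
    rewrite -restrict_EFin; apply: (integrable_mkcond _ _).1 => //.
    by apply: locint_itv; exact: continuous_locint.
  have Gf s : s <= x -> G r q f s = u s * w.
    move=> sx; rewrite G_weights//; congr (_ * _).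
    under eq_Rintegral do rewrite vf.
    rewrite -Rintegral_mkcondr; congr Rintegral.
    apply/seteqP; split => t /=; rewrite !in_itv/= ?andbT.
      by move=> [].
    by move=> /[dup] /andP[xt _] ->; split => //; rewrite (le_trans sx).
  have [_ GLp] := GC f f_Lp; rewrite !LnormE f_norm => GfC.
  have uw : ((w `^ p)%:E * U <= \int[mu]_s (`|G r q f s| `^ p)%:E)%E.
    have mup : measurable_fun `]-oo, x] (fun s => (u s `^ p)%:E).
      exact: (measurable_continuous_EFin (D := `]-oo, x]%classic) upC).
    have up0 s : `]-oo, x]%classic s -> (0 <= (u s `^ p)%:E)%E.
      by move=> _; rewrite lee_fin powR_ge0.
    have -> := esym (ge0_integralZl_EFin mu (measurable_itv _) up0 mup (powR_ge0 w p)).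
    have mG : measurable_fun setT (fun s => `|G r q f s| `^ p).
      apply: (measurableT_comp (measurable_powR p)).
      apply: measurableT_comp => //; exact: Lfun_measurable GLp.
    apply: (@le_trans _ _ (\int[mu]_(s in `]-oo, x]) (`|G r q f s| `^ p)%:E)%E).
      apply: ge0_le_integral => //.
      - by move=> s _; rewrite -EFinM lee_fin mulr_ge0// powR_ge0.
      - by apply: measurable_funeM; exact: measurable_continuous_EFin.
      - by apply/measurable_EFinP; exact: measurable_funTS.
      move=> s /=; rewrite in_itv/= => sx.
      rewrite Gf// ger0_norm ?mulr_ge0 ?(ltW (u0 s))// powRM ?(ltW (u0 s))//.
      by rewrite -EFinM lee_fin mulrC.
    apply: ge0_subset_integral => //; exact/measurable_EFinP.
  have wp0 : (0 <= (w `^ p)%:E)%E by rewrite lee_fin powR_ge0.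
  have := lee_poweR _ (mule_ge0 wp0 (ltW U_gt0)) uw.
  move=> /(_ p^-1); rewrite invr_ge0 => /(_ (ltW p_gt0)) uw'.
  have := le_trans uw' GfC.
  by rewrite poweRM ?(ltW U_gt0)// !poweR_EFin powRK ?gt_eqF.
have U_fin : U \is a fin_num.
  have [|w wE [wU _]] := test (x + 1); first by rewrite lerDl.
  have w_gt0 : 0 < w.
    rewrite -lte_fin -wE; apply: integral_itv_gt0 => //; last by rewrite ltrDl.
    by move=> t; exact: powR_gt0.
  rewrite ge0_fin_numE ?ltW// ltey; apply/eqP => Uy.
  move: wU; rewrite Uy poweRyr; last by rewrite invr_eq0 gt_eqF.
  by rewrite gt0_muley ?lte_fin.
pose l := fine U `^ p^-1.
have lE : (U `^ p^-1 = l%:E)%E by rewrite -poweR_EFin fineK.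
have l_gt0 : 0 < l.
  by rewrite powR_gt0// -lte_fin fineK.
rewrite [X in (X * _)%E]lE.
have Cl0 : 0 <= C / l by rewrite divr_ge0// ltW.
have V_le : (upper_tail p' v x <= ((C / l) `^ p')%:E)%E.
  apply: ge0_integral_itvcy_le.
  - exact: continuous_measurable_fun.
  - by move=> t; exact: powR_ge0.
  move=> b xb; have [w -> [wU w0]] := test b xb.
  rewrite lee_fin.
  have [->|w_neq0] := eqVneq w 0; first exact: powR_ge0.
  have w_gt0 : 0 < w by rewrite lt_neqAle eq_sym w_neq0.
  move: wU; rewrite lE -EFinM lee_fin => wU.
  have wl : w `^ p'^-1 <= C / l.
    rewrite ler_pdivlMr// -(ler_pM2r (powR_gt0 p^-1 w_gt0)).
    rewrite mulrAC -powRD; last by rewrite w_neq0 implybT.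
    by rewrite addrC pp' powRr1.
  rewrite -[leLHS](powRK (s := p'^-1) w0) ?invr_eq0 ?gt_eqF// invrK.
  by apply: ge0_ler_powR; rewrite ?nnegrE ?powR_ge0 ?(ltW p'_gt0).
have V_ge0 : (0 <= upper_tail p' v x)%E.
  by apply: integral_ge0 => t _; rewrite lee_fin powR_ge0.
have := lee_poweR _ V_ge0 V_le => /(_ p'^-1).
rewrite invr_ge0 => /(_ (ltW p'_gt0)).
rewrite poweR_EFin powRK ?gt_eqF// => V_le'.
apply: (@le_trans _ _ (l%:E * (C / l)%:E)%E).
  by apply: lee_wpmul2l => //; rewrite lee_fin ltW.
by rewrite -EFinM lee_fin mulrC divfK// gt_eqF.
Qed.

Lemma Mpx_le_tails M : (forall x, (Mpx r q p x <= M%:E)%E) ->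
  exists L V : R -> R, [/\ forall x, lower_tail p u x = (L x)%:E,
    forall x, upper_tail p' v x = (V x)%:E &
    forall x, L x `^ p^-1 * V x `^ p'^-1 <= M].
Proof.
move=> Mpx_le.
have muck x : (lower_tail p u x `^ p^-1 * upper_tail p' v x `^ p'^-1 <= M%:E)%E.
  by rewrite -Mpx_tails.
have lE x := fineK (lower_tail_fin p_gt1 uC u0 vC v0 (muck x)).
have uE x := fineK (upper_tail_fin p'_gt1 uC u0 vC v0 (muck x)).
exists (fun x => fine (lower_tail p u x)), (fun x => fine (upper_tail p' v x)).
split=> x; [exact/esym/lE|exact/esym/uE|].
have aux (a b : \bar R) : a \is a fin_num -> b \is a fin_num ->
    (a `^ p^-1 * b `^ p'^-1 <= M%:E)%E -> fine a `^ p^-1 * fine b `^ p'^-1 <= M.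
  by move: a b => [a||] [b||].
apply: aux (muck x); first exact: (lower_tail_fin p_gt1 uC u0 vC v0 (muck x)).
exact: (upper_tail_fin p'_gt1 uC u0 vC v0 (muck x)).
Qed.

Section bounded.
Variables (L V : R -> R) (M : R).
Hypotheses (lower_tailE : forall x, lower_tail p u x = (L x)%:E).
Hypotheses (upper_tailE : forall x, upper_tail p' v x = (V x)%:E).
Hypotheses (real_muck : forall x, L x `^ p^-1 * V x `^ p'^-1 <= M).

Lemma Lfun_weight_integrable f : f \in Lfun mu p%:E -> weight_integrable f.
Proof.
move=> fLp x; have mf := Lfun_measurable fLp.
apply/integrableP; split.
  apply/measurable_EFinP; apply: measurable_funTS.
  by apply: measurable_funM => //; exact: continuous_measurable_fun.
under eq_integral => t _ do rewrite /= normrM (ger0_norm (ltW (v0 t))).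
apply: (upper_integral_lty p_gt1 p'_gt1 pp' vC v0 upper_tailE
  (f := fun t => `|f t|)) => //.
  exact: measurableT_comp.
exact: Lfun_lty.
Qed.

(** |Gf| is at most the operator applied to |f|, to which [weighted_hardy]
    applies; the p-th root of p p'^(p/p') M^p is p^(1/p) p'^(1/p') M. *)
Lemma G_bounded_Mp : G_bound r q p (p `^ p^-1 * p' `^ p'^-1 * M).
Proof.
have M0 : 0 <= M by apply: le_trans (real_muck 0); rewrite mulr_ge0 ?powR_ge0.
split; first by rewrite !mulr_ge0 ?powR_ge0.
move=> f fLp; have mf := Lfun_measurable fLp.
have ivf := Lfun_weight_integrable fLp.
have lf := Lfun_locint p_gt1 fLp.
have mG := continuous_measurable_fun (G_continuous lf ivf).
have nfLp := Lfun_norm_in p_gt0 fLp.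
have mnf := Lfun_measurable nfLp.
have invf := Lfun_weight_integrable nfLp.
pose C x := \int[mu]_(t in `[x, +oo[) (v t * `|f t|).
have CE x : (\int[mu]_(t in `[x, +oo[) (v t * `|f t|)%:E = (C x)%:E)%E.
  apply/esym/fineK.
  by apply: integrable_fin_num => //; exact: (invf x).
have C0 x : 0 <= C x by apply: Rintegral_ge0 => t _; rewrite mulr_ge0// ltW.
have GC x : `|G r q f x| <= u x * C x.
  rewrite G_weights// normrM (ger0_norm (ltW (u0 x))) ler_wpM2l ?(ltW (u0 x))//.
  apply: (le_trans (le_normr_Rintegral _ _)) => //.
  apply: le_Rintegral => //; first exact: (integrable_norm (ivf x)).
  - by move=> t _; rewrite normrM (ger0_norm (ltW (v0 t))).
have fy := Lfun_lty p_gt0 fLp.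
have hardy := weighted_hardy p_gt1 p'_gt1 pp' uC u0 vC v0 lower_tailE upper_tailE
  real_muck mnf (fun x => normr_ge0 (f x)) CE.
have C_cont : continuous (fun x => u x * C x).
  move=> x; apply: cvgM; first exact: uC.
  have lvf : locint (fun t => v t * `|f t|) by exact/locintM/(Lfun_locint p_gt1 nfLp).
  have -> : C = fun x => \int[mu]_(t in `[0, +oo[) (v t * `|f t|) -
      prim (fun t => v t * `|f t|) x.
    by apply/funext => y; rewrite /C (Rintegral_itvcy_prim _ lvf).
  by apply: cvgB; [exact: cvg_cst|exact: prim_continuous].
have K0 : 0 <= p * p' `^ (p / p') * M `^ p.
  by rewrite !mulr_ge0 ?powR_ge0// ltW.
have GK : (\int[mu]_x (`|G r q f x| `^ p)%:E <=
    (p * p' `^ (p / p') * M `^ p)%:E * \int[mu]_x (`|f x| `^ p)%:E)%E.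
  apply: le_trans hardy; apply: ge0_le_integral => //.
  - apply/measurable_EFinP; apply: (measurableT_comp (measurable_powR p)).
    exact: measurableT_comp.
  - apply/measurable_EFinP; apply: (measurableT_comp (measurable_powR p)).
    exact: continuous_measurable_fun.
  - move=> x _; rewrite lee_fin; apply: ge0_ler_powR; rewrite ?nnegrE ?(ltW p_gt0)//.
    by rewrite mulr_ge0// ltW.
split.
- by move=> x; exact: integrable_Gintegrand.
- apply: (in_Lfun mG); apply: (le_lt_trans GK).
  by rewrite lte_mul_pinfty.
rewrite !LnormE.
have nG0 : (0 <= \int[mu]_x (`|G r q f x| `^ p)%:E)%E.
  by apply: integral_ge0 => x _; rewrite lee_fin powR_ge0.
have nf0 : (0 <= \int[mu]_x (`|f x| `^ p)%:E)%E.
  by apply: integral_ge0 => x _; rewrite lee_fin powR_ge0.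
have pV0 : 0 <= p^-1 by rewrite invr_ge0 ltW.
apply: (le_trans (lee_poweR pV0 nG0 GK)).
rewrite poweRM// poweR_EFin.
have -> : (p * p' `^ (p / p') * M `^ p) `^ p^-1 = p `^ p^-1 * p' `^ p'^-1 * M.
  have p0 := ltW p_gt0; have p'0 := powR_ge0 p' (p / p'); have Mp0 := powR_ge0 M p.
  rewrite (powRM _ (mulr_ge0 p0 p'0) Mp0) (powRM _ p0 p'0).
  rewrite (powRK M0 (lt0r_neq0 p_gt0)) -powRrM (_ : p / p' * p^-1 = p'^-1)//.
  by field; rewrite !gt_eqF.
by [].
Qed.

End bounded.

(** * Solutions of the equation *)

Lemma uVE x : (u x)^-1 = expR (- Q x). Proof. by rewrite expRN. Qed.

Lemma v_uV x : v x = (r x)^-1 * (u x)^-1.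
Proof. by rewrite uVE. Qed.

Lemma abs_continuous_Q : abs_continuous Q.
Proof. by move=> a b ab; exact: prim_abs_continuous. Qed.

Lemma is_derive_uV (x : R) : is_derive x 1 Q (q x / r x) ->
  is_derive x 1 (fun t => (u t)^-1) (- (q x / r x) * (u x)^-1).
Proof.
move=> dQ; rewrite (_ : (fun t => _) = expR \o (- Q)); last first.
  by apply/funext => t; rewrite uVE.
have dNQ : is_derive x 1 (- Q) (- (q x / r x)) by exact: is_deriveN.
apply: is_derive_eq (is_derive1_comp (is_derive_expR _) dNQ) _.
by rewrite -uVE mulrC.
Qed.

Lemma is_derive_u (x : R) : is_derive x 1 Q (q x / r x) ->
  is_derive x 1 u ((q x / r x) * u x).
Proof.
move=> dQ; apply: is_derive_eq (is_derive1_comp (is_derive_expR _) dQ) _.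
exact: mulrC.
Qed.

(** Almost everywhere (y/u)' = - v f. *)
Lemma solution_constant f y : locint f -> is_solution r q f y ->
  forall a b, y a / u a + prim (fun t => v t * f t) a =
              y b / u b + prim (fun t => v t * f t) b.
Proof.
move=> lf [acy yae _ _].
have lvf : locint (fun t => v t * f t) by exact: locintM.
apply: (@abs_continuous_derive0 _ (fun x => y x / u x + prim (fun t => v t * f t) x)).
  apply: abs_continuousD; last by move=> a b ab; exact: prim_abs_continuous.
  apply: abs_continuousM => //.
  have -> : (fun x => (u x)^-1) = (fun x => expR (- Q x)).
    by apply/funext => x; rewrite uVE.
  apply: abs_continuous_expR; apply: abs_continuousN; exact: abs_continuous_Q.
have dQ := is_derive_prim_ae c_loc.
have dvf := is_derive_prim_ae lvf.
have FF : Filter (almost_everywhere mu) by exact: (ae_filter_ringOfSetsType mu).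
apply: filterS3 yae dQ dvf => x [dy yE] dQx dvfx.
have dy' : is_derive x 1 y (derive1 y x) by rewrite derive1E; apply: DeriveDef.
have duV := is_derive_uV dQx.
apply: is_derive_eq (is_deriveD (is_deriveM dy' duV) dvfx) _.
rewrite /GRing.scale/= v_uV -yE.
by field; rewrite !gt_eqF.
Qed.

Lemma Q_ge0 b : 0 <= b -> 0 <= Q b.
Proof. by move=> b0; rewrite -(prim0 (fun s => q s / r s)); exact: Q_le. Qed.

Lemma u_ge1 b : 0 <= b -> 1 <= u b.
Proof. by move=> b0; rewrite -expR0 ler_expR Q_ge0. Qed.

Lemma solution_decay f y e : is_solution r q f y -> 0 < e ->
  \forall b \near +oo, `|y b / u b| <= e.
Proof.
move=> [_ _ _ /cvgrPdist_le yy] e0.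
have {}yy := yy e e0.
near=> b.
have yb : `|y b| <= e.
  by rewrite -normrN -[- _]add0r; near: b.
have b0 : 0 <= b by near: b; apply: nbhs_pinfty_ge; rewrite num_real.
rewrite normrM normfV (ger0_norm (ltW (u0 b))) ler_pdivrMr//.
apply: (le_trans yb); rewrite ler_peMr ?u_ge1//; exact: ltW.
Unshelve. all: by end_near. Qed.

(** Let the second point tend to +oo in [solution_constant]. *)
Lemma solution_eq_G f y : locint f -> weight_integrable f ->
  is_solution r q f y -> y = G r q f.
Proof.
move=> lf ivf sy.
have lvf : locint (fun t => v t * f t) by exact: locintM.
pose K := \int[mu]_(t in `[0, +oo[) (v t * f t).
pose P := prim (fun t => v t * f t).
have sol := solution_constant lf sy.
have c0 : forall x, y x / u x + P x - K = 0.
  move=> x; apply/eqP; rewrite -normr_le0; apply/ler_addgt0Pr => e e0; rewrite add0r.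
  have e20 : 0 < e / 2 by rewrite divr_gt0.
  have tail := integrable_itvcy_tail lvf ivf.
  move/cvgrPdist_le : tail => /(_ _ e20) tail.
  have dec := solution_decay sy e20.
  have [b [yb Pb]] : exists b, `|y b / u b| <= e / 2 /\ `|K - P b| <= e / 2.
    near (pinfty_nbhs R) => b; exists b; split; first by near: b.
    rewrite /K /P -(Rintegral_itvcy_prim _ lvf)// -normrN -[- _]add0r.
    by near: b.
  rewrite /P (sol x b) -/P -addrA -(opprB K) (le_trans (ler_normB _ _))//.
  by rewrite [leRHS](splitr e) lerD.
apply/funext => x; rewrite G_weights// (Rintegral_itvcy_prim _ lvf)// -/K -/P.
have /eqP := c0 x; rewrite subr_eq0 => /eqP <-; rewrite addrK mulrC divfK//.
by rewrite gt_eqF.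
Unshelve. all: by end_near. Qed.

(** For f >= 0 the integrals over [x, b] increase with b, and
    [solution_constant] bounds them. *)
Lemma solution_weight_integrable f y : locint f -> (forall x, 0 <= f x) ->
  is_solution r q f y -> weight_integrable f.
Proof.
move=> lf f0 sy x.
have lvf : locint (fun t => v t * f t) by exact: locintM.
have vf0 t : 0 <= v t * f t by rewrite mulr_ge0// ltW.
have mvf := locint_measurable lvf.
apply/integrableP; split; first by apply/measurable_EFinP; exact: measurable_funTS.
under eq_integral => t _ do rewrite /= ger0_norm//.
apply: (@le_lt_trans _ _ (y x / u x + 1)%:E); last exact: ltry.
apply: ge0_integral_itvcy_le => // b xb.
have /fineK <- : ((\int[mu]_(t in `[x, b]) (v t * f t)%:E) \is a fin_num)%E.
  by apply: integrable_fin_num => //; exact: (locint_itv _ _ lvf).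
rewrite lee_fin -/(Rintegral mu `[x, b] (fun t => v t * f t)) primB//.
have dec := solution_decay sy ltr01.
near (pinfty_nbhs R) => d.
have yd : `|y d / u d| <= 1 by near: d.
have bd : b <= d by near: d; apply: nbhs_pinfty_ge; rewrite num_real.
have Pbd := prim_le lvf vf0 bd.
have := solution_constant lf sy x d; move: yd Pbd.
move: (prim _ x) (prim _ b) (prim _ d) (y x / u x) (y d / u d) => A B C D E.
by move=> /ler_normlP[E2 E3]; lra.
Unshelve. all: by end_near. Qed.

(** The integrability of v f for a signed f follows from the solution of the
    equation with right-hand side |f|. *)
Lemma correctly_solvable_G_bound : correctly_solvable r q p ->
  (exists C, G_bound r q p C) /\
  forall f, f \in Lfun mu p%:E -> is_solution r q f (G r q f).
Proof.
move=> [sol [c c0 cP]].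
have ivf f : f \in Lfun mu p%:E -> weight_integrable f.
  move=> fLp; have nfLp := Lfun_norm_in p_gt0 fLp.
  have [y [[sy _] _]] := sol _ nfLp.
  have ivnf := solution_weight_integrable (Lfun_locint p_gt1 nfLp)
    (fun x => normr_ge0 (f x)) sy.
  move=> x; apply: le_integrable (ivnf x) => //.
    apply/measurable_EFinP; apply: measurable_funTS.
    exact: (locint_measurable (locintM vC (Lfun_locint p_gt1 fLp))).
  by move=> t _; rewrite lee_fin !normrM normr_id.
have solG f : f \in Lfun mu p%:E ->
    is_solution r q f (G r q f) /\ G r q f \in Lfun mu p%:E.
  move=> fLp; have [y [[sy yLp] _]] := sol _ fLp.
  by rewrite -(solution_eq_G (Lfun_locint p_gt1 fLp) (ivf f fLp) sy).
split; last by move=> f /solG[].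
exists c; split; first exact: ltW.
move=> f fLp; have [sG GLp] := solG f fLp; split => //.
  by move=> x; apply: integrable_Gintegrand => //; exact: ivf.
exact: cP.
Qed.

Lemma G_abs_continuous f : locint f -> weight_integrable f ->
  abs_continuous (G r q f).
Proof.
move=> lf ivf.
have lvf : locint (fun t => v t * f t) by exact: locintM.
have -> : G r q f = fun x =>
    u x * (\int[mu]_(t in `[0, +oo[) (v t * f t) + - prim (fun t => v t * f t) x).
  by apply/funext => x; rewrite G_weights// (Rintegral_itvcy_prim _ lvf).
apply: abs_continuousM; first exact: abs_continuous_expR abs_continuous_Q.
apply: abs_continuousD; first exact: abs_continuous_cst.
by apply: abs_continuousN => a b ab; exact: prim_abs_continuous.
Qed.

Lemma G_solution f : locint f -> weight_integrable f ->
  G r q f x @[x --> -oo] --> (0 : R) -> G r q f x @[x --> +oo] --> (0 : R) ->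
  is_solution r q f (G r q f).
Proof.
move=> lf ivf GNy Gy; split => //; first exact: G_abs_continuous.
have lvf : locint (fun t => v t * f t) by exact: locintM.
have dQ := is_derive_prim_ae c_loc.
have dvf := is_derive_prim_ae lvf.
have FF : Filter (almost_everywhere mu) by exact: (ae_filter_ringOfSetsType mu).
apply: filterS2 dQ dvf => x dQx dvfx.
have GE : G r q f = (u * (cst (\int[mu]_(t in `[0, +oo[) (v t * f t)) -
    prim (fun t => v t * f t)))%R.
  by apply/funext => t; rewrite G_weights// (Rintegral_itvcy_prim _ lvf).
have dG : is_derive x 1 (G r q f) ((q x * G r q f x - f x) / r x).
  rewrite {1}GE.
  have dC := is_deriveD (is_derive_cst (\int[mu]_(t in `[0, +oo[) (v t * f t)) x 1)
    (is_deriveN dvfx).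
  apply: is_derive_eq (is_deriveM (is_derive_u dQx) dC) _.
  rewrite G_weights// (Rintegral_itvcy_prim x lvf)//.
  rewrite /GRing.scale/= !fctE/= (v_uV x).
  by field; rewrite !gt_eqF.
have [dG1 dG2] := dG; split => //.
by rewrite derive1E dG2; field; rewrite gt_eqF.
Qed.

(** * The interval condition and the upper tail *)

Let rpC : continuous (fun t => (r t `^ p')^-1).
Proof.
have := continuous_powR (s := - p') r_cont r_gt0.
by under eq_fun do rewrite powRN.
Qed.

Lemma S1_Q_unbounded K : S1 r q = +oo%E -> exists2 x, x <= 0 & Q x < K.
Proof.
move=> S1y; apply: contrapT => nx.
suff : (S1 r q <= (- K)%:E)%E by rewrite S1y.
apply: ge0_integral_itvNyc_le; [exact: locint_measurable c_loc|exact: qr_ge0|].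
move=> a a0; rewrite -[leLHS]fineK; last first.
  by apply: integrable_fin_num => //; exact: (locint_itv _ _ c_loc).
rewrite lee_fin -/(Rintegral mu `[a, 0] (fun s => q s / r s)) mass//.
rewrite Q0 sub0r lerN2 leNgt; apply/negP => Qa.
by apply: nx; exists a.
Qed.

Lemma Q_intermediate a b y : a <= b -> Q a <= y -> y <= Q b ->
  exists2 c, a <= c <= b & Q c = y.
Proof.
move=> ab ay yb.
have [|c cab Qc] := @IVT R Q a b y ab (continuous_subspaceT QC).
  by rewrite ge_min ay le_max yb orbT.
by exists c => //; move: cab; rewrite in_itv/=.
Qed.

(** A radius in the set that defines d(x) is larger than [d], for otherwise the
    mass of its interval would be less than 2.  The set is not empty, because Q
    tends to -oo at -oo and the mass depends continuously on the radius. *)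
Lemma dfun_ge x d : S1 r q = +oo%E -> 0 <= d -> Q (x + d) - Q (x - d) < 2 ->
  d <= dfun r q x.
Proof.
move=> S1y d0 Qd; apply: lb_le_inf; last first.
  move=> e /= [e0 me]; rewrite leNgt; apply/negP => ed.
  have h1 : Q (x + e) <= Q (x + d) by apply: Qle; lra.
  have h2 : Q (x - d) <= Q (x - e) by apply: Qle; lra.
  have := lerB h1 h2; rewrite -mass; [|done..|lra]; rewrite me leNgt.
  by rewrite Qd.
have [a a0 Qa] := S1_Q_unbounded (Num.min (Q x - 2) (Q (x - d))) S1y.
move: Qa; rewrite lt_min => /andP[Qa1 Qa2].
have ax : a < x by rewrite ltNge; apply/negP => /Qle; rewrite leNgt; move/negP; apply; lra.
pose g e := Q (x + e) - Q (x - e).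
have gC : continuous g.
  move=> e; apply: cvgB.
    apply: (@continuous_comp _ _ _ (fun e => x + e) Q); last exact: QC.
    by apply: cvgD; [exact: cvg_cst|exact: cvg_id].
  apply: (@continuous_comp _ _ _ (fun e => x - e) Q); last exact: QC.
  by apply: cvgB; [exact: cvg_cst|exact: cvg_id].
have g0 : g 0 = 0 by rewrite /g addr0 subr0 subrr.
have gD : 2 <= g (x - a).
  have h1 : Q x <= Q (x + (x - a)) by apply: Qle; lra.
  rewrite /g (_ : x - (x - a) = a); last by ring.
  by apply: le_trans (lerD h1 (lexx (- Q a))); lra.
have [||e] := @IVT R g 0 (x - a) 2 _ (continuous_subspaceT gC).
- by rewrite subr_ge0 ltW.
- by rewrite g0 ge_min le_max gD orbT ler0n.
rewrite in_itv/= => /andP[e0 _] ge.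
have e_gt0 : 0 < e.
  rewrite lt_neqAle e0 andbT; apply/eqP => e00.
  by move: ge; rewrite -e00 g0; lra.
by exists e; split => //; rewrite mass//; lra.
Qed.

(** By [dfun_ge], [a, b] is contained in the interval of radius d(m) about its
    midpoint m. *)
Lemma small_mass_le_Ap a b : S1 r q = +oo%E -> a <= b -> Q b - Q a < 2 ->
  (\int[mu]_(t in `[a, b]) ((r t `^ p')^-1)%:E <= Ap r q p)%E.
Proof.
move=> S1y ab Qab.
pose m := (a + b) / 2; pose h := (b - a) / 2.
have hm : h <= dfun r q m.
  apply: dfun_ge => //; first by rewrite /h; lra.
  by rewrite (_ : m + h = b) 1?(_ : m - h = a)//; rewrite /m /h; field.
apply: (@le_trans _ _ (Apx r q p m)); last by apply: ereal_sup_ubound; exists m.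
apply: ge0_subset_integral => //.
  apply/measurable_EFinP; apply: measurable_funTS.
  exact: continuous_measurable_fun.
  by move=> t _; rewrite lee_fin invr_ge0 powR_ge0.
by move=> t /=; rewrite !in_itv/= /m /h in hm *; lra.
Qed.

(** Only the mass of q/r between [x] and [t] matters: on an interval of bounded
    mass the left-hand side is comparable with 1/r(t)^p'. *)
Lemma uv_powR x t : u x `^ p' * v t `^ p' = (r t `^ p')^-1 * expR (- p' * (Q t - Q x)).
Proof.
rewrite v_powR// u_powR mulrCA -expRD; congr (_ * expR _); ring.
Qed.

Section bounded.
Variable A : R.
Hypothesis A_ge0 : 0 <= A.
Hypothesis small_mass : forall a b, a <= b -> Q b - Q a < 2 ->
  \int[mu]_(t in `[a, b]) (r t `^ p')^-1 <= A.

(** The sum of the geometric series of first term [A] and ratio e^(-p'). *)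
Let B := A / (1 - expR (- p')).

Let B_ge : A + expR (- p') * B = B.
Proof.
have e1 : expR (- p') < 1 by rewrite expR_lt1 oppr_lt0.
by rewrite /B; field; rewrite gt_eqF// subr_gt0.
Qed.

(** By induction on the mass of [x, T]: a first piece of mass 1 contributes at
    most [A], and crossing it damps the contribution of the rest by e^(-p'). *)
Lemma truncated_upper_tail_le n x T : x <= T -> Q T - Q x <= n%:R ->
  u x `^ p' * \int[mu]_(t in `[x, T]) (v t `^ p') <= B.
Proof.
have B0 : 0 <= B by rewrite divr_ge0// subr_ge0 -expR0 ler_expR oppr_le0 ltW.
have first_step a b : a <= b -> Q b - Q a < 2 ->
    u a `^ p' * \int[mu]_(t in `[a, b]) (v t `^ p') <= A.
  move=> ab Qab; apply: le_trans (small_mass ab Qab).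
  rewrite -RintegralZl//; last by apply: locint_itv; exact: continuous_locint.
  apply: le_Rintegral => //.
  - apply: locint_itv; apply: continuous_locint => t.
    by apply: cvgM; [exact: cvg_cst|exact: vpC].
  - by apply: locint_itv; exact: continuous_locint.
  move=> t /=; rewrite in_itv/= => /andP[ta tb].
  rewrite uv_powR ler_piMr ?invr_ge0 ?powR_ge0// -expR0 ler_expR.
  by rewrite mulNr oppr_le0 mulr_ge0 ?subr_ge0 ?Qle// ltW.
elim: n x => [|n IH] x xT QxT.
  apply: (le_trans (first_step _ _ xT _)); first by lra.
  by rewrite -B_ge lerDl mulr_ge0// expR_ge0.
have [QT1|QT1] := ltP (Q T - Q x) 2.
  apply: (le_trans (first_step _ _ xT QT1)).
  by rewrite -B_ge lerDl mulr_ge0// expR_ge0.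
have [||c /andP[xc cT] Qc] := @Q_intermediate x T (Q x + 1) xT; [lra|lra|].
rewrite (Rintegral_chasles (continuous_locint vpC) xc cT) mulrDr -B_ge.
apply: lerD; first by apply: first_step => //; lra.
have -> : u x `^ p' = expR (- p') * u c `^ p'.
  transitivity (expR (- p' + p' * Q c)); last by rewrite expRD -u_powR.
  by rewrite u_powR Qc; congr expR; ring.
rewrite -mulrA ler_pM2l ?expR_gt0//; apply: IH => //.
by move: QxT; rewrite -natr1; lra.
Qed.

Lemma upper_tail_le x : ((u x `^ p')%:E * upper_tail p' v x <= B%:E)%E.
Proof.
have up0 : 0 < u x `^ p' by rewrite powR_gt0.
have : (upper_tail p' v x <= (B / u x `^ p')%:E)%E.
  apply: ge0_integral_itvcy_le.
  - exact: continuous_measurable_fun.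
  - by move=> t; rewrite powR_ge0.
  move=> T xT; rewrite -[leLHS]fineK; last first.
    by apply: integrable_fin_num => //; apply: locint_itv; exact: continuous_locint.
  rewrite lee_fin -/(Rintegral mu `[x, T] (fun t => v t `^ p')) ler_pdivlMr// mulrC.
  apply: (@truncated_upper_tail_le (Num.truncn (Q T - Q x)).+1) => //.
  exact/ltW/truncnS_gt.
move=> h; apply: (@le_trans _ _ ((u x `^ p')%:E * (B / u x `^ p')%:E)%E).
  by apply: lee_wpmul2l => //; rewrite lee_fin ltW.
by rewrite -EFinM lee_fin mulrC divfK// gt_eqF.
Qed.

End bounded.

Lemma upper_tail_bounded_of_Ap : S1 r q = +oo%E -> (Ap r q p < +oo)%E ->
  exists2 B, 0 <= B & forall x, ((u x `^ p')%:E * upper_tail p' v x <= B%:E)%E.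
Proof.
move=> S1y Apy.
have Ap0 : (0 <= Ap r q p)%E.
  apply: (@le_trans _ _ (Apx r q p 0)); last by apply: ereal_sup_ubound; exists 0.
  by apply: integral_ge0 => t _; rewrite lee_fin invr_ge0 powR_ge0.
have ApE : Ap r q p = (fine (Ap r q p))%:E by rewrite fineK// ge0_fin_numE.
have A0 : 0 <= fine (Ap r q p) by exact: fine_ge0.
exists (fine (Ap r q p) / (1 - expR (- p'))).
  by rewrite divr_ge0// subr_ge0 -expR0 ler_expR oppr_le0 ltW.
apply: upper_tail_le => // a b ab Qab.
have := small_mass_le_Ap S1y ab Qab; rewrite ApE -[leLHS]fineK ?lee_fin//.
apply: integrable_fin_num => //; apply: locint_itv; exact: continuous_locint.
Qed.

(** The interval of radius d about [x] has mass at most 2, so that on it the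
    integrand of W(x - d) is at least e^(-2p') / r^p'. *)
Lemma Ap_bounded_of_upper_tail B :
  (forall x, ((u x `^ p')%:E * upper_tail p' v x <= B%:E)%E) ->
  (Ap r q p <= (expR (2 * p') * B)%:E)%E.
Proof.
move=> WB; apply: ge_ereal_sup => _ [x _ <-].
rewrite /Apx; set d := dfun r q x.
have d0 : 0 <= d.
  rewrite /d /dfun; have [->|/set0P S0] := eqVneq [set d : R | 0 < d /\
      \int[mu]_(t in `[x - d, x + d]) (q t / r t) = 2] set0.
    by rewrite inf0.
  by apply: lb_le_inf => // e [/ltW].
have Qd : Q (x + d) - Q (x - d) <= 2.
  rewrite /d /dfun; have [->|/set0P[e [e0 me]]] := eqVneq [set d : R | 0 < d /\
      \int[mu]_(t in `[x - d, x + d]) (q t / r t) = 2] set0.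
    by rewrite inf0 addr0 subr0 subrr ler0n.
  have de : d <= e.
    by apply: ge_inf; [exists 0 => z [/ltW]|].
  rewrite mass in me; last by lra.
  have h1 : Q (x + d) <= Q (x + e) by apply: Qle; lra.
  have h2 : Q (x - e) <= Q (x - d) by apply: Qle; lra.
  by rewrite -/d; have := lerB h1 h2; rewrite me.
have up0 := powR_gt0 p' (u0 (x - d)).
rewrite EFinM; apply: le_trans (lee_wpmul2l _ (WB (x - d))); last first.
  by rewrite lee_fin expR_ge0.
rewrite muleA -EFinM.
have K0 : 0 <= expR (2 * p') * u (x - d) `^ p' by rewrite mulr_ge0 ?expR_ge0 ?ltW.
have vp0 t : `[x - d, +oo[%classic t -> (0 <= (v t `^ p')%:E)%E.
  by move=> _; rewrite lee_fin powR_ge0.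
have mvp : measurable_fun `[x - d, +oo[ (fun t => (v t `^ p')%:E).
  exact: (measurable_continuous_EFin (D := `[x - d, +oo[%classic) vpC).
rewrite [leRHS](esym (ge0_integralZl_EFin mu (measurable_itv _) vp0 mvp K0)).
apply: (@le_trans _ _ (\int[mu]_(t in `[(x - d)%R, (x + d)%R])
    ((expR (2 * p') * u (x - d) `^ p')%:E * (v t `^ p')%:E))%E).
  apply: ge0_le_integral => //.
  - by move=> t _; rewrite lee_fin invr_ge0 powR_ge0.
  - exact: measurable_continuous_EFin.
  - apply: measurable_funeM; exact: measurable_continuous_EFin.
  move=> t /=; rewrite in_itv/= => /andP[ta tb].
  rewrite -EFinM lee_fin -mulrA uv_powR mulrCA ler_peMr ?invr_ge0 ?powR_ge0//.
  rewrite -expRD -[leLHS]expR0 ler_expR.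
  have Qt : Q t - Q (x - d) <= 2 by rewrite (le_trans _ Qd)// lerB// Qle.
  rewrite [leRHS](_ : _ = p' * (2 - (Q t - Q (x - d)))); last by ring.
  by rewrite mulr_ge0 ?subr_ge0// ltW.
apply: ge0_subset_integral => //.
- apply: measurable_funeM; exact: measurable_continuous_EFin.
- move=> t _; rewrite -EFinM lee_fin mulr_ge0 ?powR_ge0//.
- by move=> t /=; rewrite !in_itv/= => /andP[->].
Qed.

(** * Decay of Gf *)

Section bounded_upper_tail.
Variable B : R.
Hypothesis WB : forall x, ((u x `^ p')%:E * upper_tail p' v x <= B%:E)%E.

(** The norm of f |-> u(x) * int_x^oo v f on L_p is W(x)^(1/p'). *)
Lemma weighted_integral_small (D : set (measurableTypeR R)) (f : R -> R) (x e : R) :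
  measurable D -> D `<=` `[x, +oo[%classic -> measurable_fun setT f -> 0 <= e ->
  (\int[mu]_(t in D) (`|f t| `^ p)%:E <= (e `^ p)%:E)%E ->
  ((u x)%:E * \int[mu]_(t in D) (v t * `|f t|)%:E <= (B `^ p'^-1 * e)%:E)%E.
Proof.
move=> mD Dx mf e0 fe.
have mnf : measurable_fun setT (fun t => `|f t|) by exact: measurableT_comp.
have pV0 : 0 <= p^-1 by rewrite invr_ge0 ltW.
have p'V0 : 0 <= p'^-1 by rewrite invr_ge0 ltW.
have p'p : p'^-1 + p^-1 = 1 by rewrite addrC.
have h := hoelder_on mD (continuous_measurable_fun vC) mnf (fun t => ltW (v0 t))
  (fun t => normr_ge0 (f t)) p'_gt0 p_gt0 p'p.
have u_ge0 : (0 <= (u x)%:E)%E by rewrite lee_fin ltW.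
apply: (le_trans (lee_wpmul2l u_ge0 h)).
rewrite muleA EFinM; apply: lee_pmul.
- by rewrite mule_ge0// poweR_ge0.
- exact: poweR_ge0.
- have up0 : (0 <= (u x `^ p')%:E)%E by rewrite lee_fin powR_ge0.
  have vD0 : (0 <= \int[mu]_(t in D) (v t `^ p')%:E)%E.
    by apply: integral_ge0 => t _; rewrite lee_fin powR_ge0.
  have -> : ((u x)%:E = (u x `^ p')%:E `^ p'^-1)%E.
    by rewrite poweR_EFin powRK ?gt_eqF// ltW.
  rewrite -poweRM// -[leRHS]poweR_EFin; apply: lee_poweR => //; first exact: mule_ge0.
  apply: le_trans (WB x); apply: lee_wpmul2l => //.
  apply: ge0_subset_integral => //; first exact: measurable_continuous_EFin.
  by move=> t _; rewrite lee_fin powR_ge0.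
- have fD0 : (0 <= \int[mu]_(t in D) (`|f t| `^ p)%:E)%E.
    by apply: integral_ge0 => t _; rewrite lee_fin powR_ge0.
  apply: (le_trans (lee_poweR pV0 fD0 fe)).
  by rewrite poweR_EFin powRK// gt_eqF.
Qed.

Variable f : R -> R.
Hypothesis f_Lp : f \in Lfun mu p%:E.
Hypothesis f_int : weight_integrable f.

Let mf : measurable_fun setT f. Proof. exact: Lfun_measurable f_Lp. Qed.
Let fy : (\int[mu]_t (`|f t| `^ p)%:E < +oo)%E. Proof. exact: Lfun_lty f_Lp. Qed.
Let fp_ge0 t : 0 <= `|f t| `^ p. Proof. exact: powR_ge0. Qed.
Let fp_meas : measurable_fun setT (fun t => `|f t| `^ p).
Proof. by apply: (measurableT_comp (measurable_powR p)); exact: measurableT_comp. Qed.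
Let fp_int (D : set (measurableTypeR R)) : measurable D ->
  mu.-integrable D (EFin \o (fun t => `|f t| `^ p)).
Proof.
move=> mD; apply: (@integrableS _ _ _ _ setT) => //; apply/integrableP; split.
  exact/measurable_EFinP.
by under eq_integral => t _ do rewrite /= ger0_norm//.
Qed.
Let fp_loc : locint (fun t => `|f t| `^ p).
Proof. by apply: locintP => // a b; exact: fp_int. Qed.

Let small_part (D : set (measurableTypeR R)) (x e : R) :
  measurable D -> D `<=` `[x, +oo[%classic -> 0 <= e ->
  \int[mu]_(t in D) `|f t| `^ p <= e `^ p ->
  u x * `|\int[mu]_(t in D) (v t * f t)| <= B `^ p'^-1 * e.
Proof.
move=> mD Dx e0 fe.
have ivf : mu.-integrable D (EFin \o (fun t => v t * f t)).
  by apply: (@integrableS _ _ _ mu `[x, +oo[%classic) => //; exact: (f_int x).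
apply: (@le_trans _ _ (u x * \int[mu]_(t in D) (v t * `|f t|))).
  rewrite ler_pM2l ?u0//; apply: (le_trans (le_normr_Rintegral _ _)) => //.
  by under eq_Rintegral => t _ do rewrite normrM (ger0_norm (ltW (v0 t))).
have invf : mu.-integrable D (EFin \o (fun t => v t * `|f t|)).
  apply: eq_integrable (integrable_norm ivf) => // t _ /=.
  by rewrite normrM (ger0_norm (ltW (v0 t))).
rewrite -lee_fin EFinM /Rintegral fineK; last exact: integrable_fin_num.
apply: weighted_integral_small => //.
by rewrite -[leLHS]fineK ?lee_fin//; apply: integrable_fin_num => //; exact: fp_int.
Qed.

(** The + 1 covers the case [B = 0]. *)
Let delta (e : R) : 0 < e -> exists2 d, 0 < d & B `^ p'^-1 * d <= e.
Proof.
move=> e0; exists (e / (B `^ p'^-1 + 1)).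
  by rewrite divr_gt0// ltr_wpDl ?powR_ge0.
have b0 := powR_ge0 B p'^-1.
by rewrite mulrCA ler_piMr ?(ltW e0)// ler_pdivrMr; lra.
Qed.

Lemma G_cvgy : G r q f x @[x --> +oo] --> (0 : R).
Proof.
apply/cvgrPdist_le => e e0; have [d d0 de] := delta e0.
have dp0 : 0 < d `^ p by rewrite powR_gt0.
have /cvgrPdist_le/(_ _ dp0) tail :=
  integrable_itvcy_tail fp_loc (fun x => fp_int (measurable_itv `[x, +oo[)).
near=> x; rewrite sub0r normrN G_weights// normrM (ger0_norm (ltW (u0 x))).
apply: le_trans de; apply: small_part => //; first exact: ltW.
rewrite -[leLHS]ger0_norm; last by apply: Rintegral_ge0 => t _.
by rewrite -normrN -[- _]add0r; near: x.
Unshelve. all: by end_near. Qed.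

(** Split the integral at a point [a] to the left of which f has small L_p-norm:
    the part on the left of [a] is small for every x, and the other part is a
    constant multiple of u(x), which tends to 0. *)
Lemma G_cvgNy : S1 r q = +oo%E -> G r q f x @[x --> -oo] --> (0 : R).
Proof.
move=> S1y; apply/cvgrPdist_le => e e0.
have e20 : 0 < e / 2 by rewrite divr_gt0.
have [d d0 de] := delta e20.
have dp0 : 0 < d `^ p by rewrite powR_gt0.
have [a fa] := integrable_itvNyc_tail fp_loc fp_ge0 fy dp0.
have lf := Lfun_locint p_gt1 f_Lp.
have lvf : locint (fun t => v t * f t) by exact: locintM.
pose I := \int[mu]_(t in `[a, +oo[) (v t * f t).
have k0 : 0 < e / 2 / (`|I| + 1) by rewrite divr_gt0// ltr_wpDl.
have [b _ Qb] : exists2 b, b <= 0 & Q b < ln (e / 2 / (`|I| + 1)).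
  exact: S1_Q_unbounded.
near=> x.
have xa : x <= a by near: x; apply: nbhs_ninfty_le; rewrite num_real.
have xb : x <= b by near: x; apply: nbhs_ninfty_le; rewrite num_real.
rewrite sub0r normrN G_weights//.
have -> : \int[mu]_(t in `[x, +oo[) (v t * f t) =
    \int[mu]_(t in `[x, a]) (v t * f t) + I.
  rewrite /I (Rintegral_itvcy_prim x lvf)// (Rintegral_itvcy_prim a lvf)// primB//.
  by ring.
rewrite mulrDr (le_trans (ler_normD _ _))// !normrM (ger0_norm (ltW (u0 x))).
rewrite [leRHS](splitr e); apply: lerD.
  apply: le_trans de; apply: small_part => //; last exact: fa.
    by move=> t /=; rewrite !in_itv/= => /andP[->].
  exact: ltW.
have ux : u x <= e / 2 / (`|I| + 1).
  rewrite -[leRHS]lnK ?posrE// ler_expR; apply: le_trans (ltW Qb).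
  exact: Q_le.
apply: (@le_trans _ _ (e / 2 / (`|I| + 1) * `|I|)); first exact: ler_wpM2r.
rewrite -mulrA ler_piMr ?(ltW e20)// mulrC ler_pdivrMr ?mul1r ?lerDl//.
Unshelve. all: by end_near. Qed.

End bounded_upper_tail.

(** * Condensation of singularities *)

Section condensation.

Let vp_meas : measurable_fun setT (fun t => v t `^ p').
Proof. exact: continuous_measurable_fun. Qed.

Variable V : R -> R.
Hypothesis VE : forall x, upper_tail p' v x = (V x)%:E.

Let V_gt0 x : 0 < V x.
Proof. by have := upper_tail_gt0 p' vC v0 x; rewrite VE lte_fin. Qed.

Let V_le x t : x <= t -> V t <= V x.
Proof.
move=> xt; rewrite -lee_fin -!VE; apply: ge0_subset_integral => //.
- exact: measurable_continuous_EFin.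
- by move=> s _; rewrite lee_fin powR_ge0.
- by move=> s /=; rewrite !in_itv/= !andbT; exact: le_trans.
Qed.

(** The f_n^p below are added with the weights 1/2, 1/4, ...  Here f_n is the
    extremal function v^(p'-1) V(x_n)^(-1/p) on [x_n, oo), of norm 1, of the
    functional f |-> (Gf)(x_n). *)
Let a (n : nat) : R := 1 / (2 ^ (n + 1))%:R.

Let a_gt0 n : 0 < a n.
Proof. by rewrite divr_gt0// ltr0n expn_gt0. Qed.

Let a_le1 n : a n <= 1.
Proof. by rewrite /a ler_pdivrMr ?ltr0n ?expn_gt0// mul1r ler1n expn_gt0. Qed.

Let sum_a : (\sum_(n <oo) (a n)%:E = 1)%E.
Proof.
have := @cvg_geometric_eseries_half R 1 0; rewrite expr0 divr1.
by move/cvg_lim => <-.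
Qed.

Variable x_ : nat -> R.

(** The n-th weighted power f_n^p, divided by v^p'. *)
Let h n t : R := if x_ n <= t then a n / V (x_ n) else 0.

Let h_ge0 n t : 0 <= h n t.
Proof. by rewrite /h; case: ifP => // _; rewrite divr_ge0// ltW. Qed.

Let h_meas n : measurable_fun setT (h n).
Proof.
by apply: measurable_fun_ifT => //; exact: measurable_fun_ler.
Qed.

Definition condensed_density t : R := fine (\sum_(n <oo) (h n t)%:E)%E.
Local Notation g := condensed_density.

(** The series is finite at every [t]: only the [n] with x_n <= t contribute,
    and for these V(x_n) >= V(t). *)
Let gE t : (\sum_(n <oo) (h n t)%:E = (g t)%:E)%E.
Proof.
rewrite fineK// ge0_fin_numE; last first.
  by apply: nneseries_ge0 => n _ _; rewrite lee_fin.
apply: (@le_lt_trans _ _ (\sum_(n <oo) ((V t)^-1%:E * (a n)%:E))%E).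
  apply: lee_nneseries => n _; first by rewrite lee_fin.
  rewrite -EFinM lee_fin /h; case: ifP => [xt|_].
    by rewrite mulrC ler_pM2r ?a_gt0// lef_pV2 ?posrE// V_le.
  by rewrite mulr_ge0 ?invr_ge0 ?ltW.
rewrite nneseriesZl; last by move=> n _; rewrite lee_fin ltW.
by rewrite sum_a mule1 ltry.
Qed.

Let h_le n t : h n t <= g t.
Proof.
rewrite -lee_fin -gE.
apply: (@le_trans _ _ (\sum_(0 <= i < n.+1) (h i t)%:E)%E); last first.
  by apply: nneseries_lim_ge => i _ _; rewrite lee_fin.
rewrite big_nat_recr//= leeDr//.
by apply: sume_ge0 => i _; rewrite lee_fin.
Qed.

Let g_ge0 t : 0 <= g t. Proof. exact: le_trans (h_le 0 t). Qed.

Let g_meas : measurable_fun setT g.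
Proof.
apply: (measurableT_comp (fine_measurable measurableT)).
apply: ge0_emeasurable_sum => [k x _ _|k _]; first by rewrite lee_fin.
exact/measurable_EFinP.
Qed.

Definition condensed t : R := (v t `^ p' * g t) `^ p^-1.
Local Notation f := condensed.

Let f_ge0 t : 0 <= f t. Proof. exact: powR_ge0. Qed.

Let f_meas : measurable_fun setT f.
Proof.
by apply: (measurableT_comp (measurable_powR p^-1)); exact: measurable_funM.
Qed.

Let integral_hump n : (\int[mu]_t (v t `^ p' * h n t)%:E = (a n)%:E)%E.
Proof.
transitivity (\int[mu]_(t in `[x_ n, +oo[) ((a n / V (x_ n))%:E * (v t `^ p')%:E))%E.
  rewrite [RHS]integral_mkcond; apply: eq_integral => t _; rewrite patchE.
  rewrite mem_setE in_itv/= andbT /h; case: ifP => _; last by rewrite mulr0.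
  by rewrite -EFinM mulrC.
have c0 : 0 <= a n / V (x_ n) by rewrite divr_ge0 ?ltW.
have vp0 t : `[x_ n, +oo[%classic t -> (0 <= (v t `^ p')%:E)%E.
  by move=> _; rewrite lee_fin powR_ge0.
have mvp : measurable_fun `[x_ n, +oo[ (fun t => (v t `^ p')%:E).
  exact: (measurable_continuous_EFin (D := `[x_ n, +oo[%classic) vpC).
rewrite (ge0_integralZl_EFin mu (measurable_itv _) vp0 mvp c0).
by rewrite -/(upper_tail p' v (x_ n)) VE -EFinM divfK ?gt_eqF.
Qed.

Lemma condensed_Lfun : f \in Lfun mu p%:E.
Proof.
apply: in_Lfun => //.
have -> : (\int[mu]_t (`|f t| `^ p)%:E =
    \int[mu]_t (\sum_(n <oo) (v t `^ p' * h n t)%:E))%E.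
  apply: eq_integral => t _; rewrite ger0_norm//.
  have -> : f t `^ p = v t `^ p' * g t.
    by rewrite /condensed -powRrM mulVf ?gt_eqF// powRr1// mulr_ge0 ?powR_ge0.
  rewrite EFinM -gE -nneseriesZl//; last by move=> n _; rewrite lee_fin.
rewrite integral_nneseries//.
- under eq_eseriesr do rewrite integral_hump.
  by rewrite sum_a ltry.
- move=> n; apply/measurable_EFinP.
  exact: (measurable_funM vp_meas (h_meas n)).
- by move=> n t _; rewrite lee_fin mulr_ge0// powR_ge0.
Qed.

(** f dominates (a n)^(1/p) f_n, the kernel is positive, and
    (G f_n)(x_n) = (u(x_n)^p' V(x_n))^(1/p').  The loss from (a n)^(1/p) to [a n]
    is harmless against geometric growth. *)
Lemma G_condensed_ge n : weight_integrable f ->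
  a n * (u (x_ n) `^ p' * V (x_ n)) `^ p'^-1 <= G r q f (x_ n).
Proof.
move=> wif; rewrite G_weights//.
set x := x_ n; set c := (a n / V x) `^ p^-1.
have c_ge0 : 0 <= c by exact: powR_ge0.
have pV1 : p^-1 <= 1 by rewrite invf_le1// ltW.
have ivp : mu.-integrable `[x, +oo[ (EFin \o (fun t => v t `^ p')).
  apply/integrableP; split; first exact: measurable_continuous_EFin.
  under eq_integral => t _ do rewrite /= ger0_norm ?powR_ge0//.
  by rewrite -/(upper_tail p' v x) VE ltry.
have VR : \int[mu]_(t in `[x, +oo[) (v t `^ p') = V x.
  by rewrite /Rintegral -/(upper_tail p' v x) VE.
have cV : c * V x <= \int[mu]_(t in `[x, +oo[) (v t * f t).
  have -> : c * V x = \int[mu]_(t in `[x, +oo[) (c * v t `^ p').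
    by rewrite (RintegralZl c _ ivp)// VR.
  apply: le_Rintegral => //.
    exact: (integrableZl _ c ivp).
  move=> t /=; rewrite in_itv/= andbT => xt.
  have fl : v t `^ (p' * p^-1) * c <= f t.
    rewrite powRrM /c -powRM ?powR_ge0 ?divr_ge0 ?(ltW (a_gt0 _)) ?(ltW (V_gt0 _))//.
    apply: ge0_ler_powR; rewrite ?nnegrE ?invr_ge0 ?(ltW p_gt0)//.
      by rewrite mulr_ge0 ?powR_ge0 ?divr_ge0 ?ltW.
      by rewrite mulr_ge0 ?powR_ge0.
    by rewrite ler_wpM2l ?powR_ge0//; have := h_le n t; rewrite /h xt.
  rewrite -(@mulr_powRB1 _ (v t) p')// ?(ltW (v0 t))// mulrCA.
  rewrite ler_pM2l// mulrC; apply: le_trans fl.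
  rewrite le_eqVlt; apply/orP; left; apply/eqP; congr (_ `^ _ * _).
  by rewrite /conj_exp; field; rewrite !gt_eqF// subr_gt0.
apply: (@le_trans _ _ (u x * (c * V x))); last by rewrite ler_pM2l.
have Vx0 := ltW (V_gt0 x).
rewrite powRM ?powR_ge0// powRK ?(ltW (u0 x)) ?gt_eqF// mulrCA ler_pM2l//.
have -> : c * V x = a n `^ p^-1 * V x `^ p'^-1.
  rewrite /c powRM ?invr_ge0 ?(ltW (a_gt0 n))// invr_powR// -mulrA; congr (_ * _).
  rewrite -{2}(powRr1 Vx0) -pp' powRD; last first.
    by apply/implyP => _; rewrite gt_eqF.
  by rewrite mulrA mulVf ?mul1r// gt_eqF// powR_gt0.
by rewrite ler_wpM2r ?powR_ge0// ger1_powR// a_gt0 a_le1.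
Qed.

End condensation.

(** * The criterion *)

(** Otherwise W(x_n)^(1/p') >= 4^n for suitable x_n, and the condensed function
    has (Gf)(x_n) >= 4^n / 2^(n+1). *)
Lemma upper_tail_bounded_of_G (V : R -> R) :
  (forall x, upper_tail p' v x = (V x)%:E) ->
  (forall f, f \in Lfun mu p%:E -> weight_integrable f) ->
  (forall f, f \in Lfun mu p%:E -> exists K, forall x, `|G r q f x| <= K) ->
  exists2 B, 0 <= B & forall x, ((u x `^ p')%:E * upper_tail p' v x <= B%:E)%E.
Proof.
move=> VE wi Gb; apply: contrapT => nB.
have /choice[x_ x_P] : forall n : nat,
    exists x, (4 ^+ n) `^ p' < u x `^ p' * V x.
  move=> n; apply: contrapT => nx; apply: nB; exists ((4 ^+ n) `^ p').
    exact: powR_ge0.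
  move=> x; rewrite VE -EFinM lee_fin leNgt; apply/negP => xP.
  by apply: nx; exists x.
have fLp := condensed_Lfun VE x_.
have [K GK] := Gb _ fLp.
have KP n : (2 : R) ^+ n / 2 <= K.
  apply: le_trans (ler_norm _) _.
  rewrite ger0_norm ?divr_ge0 ?exprn_ge0//.
  apply: le_trans (GK (x_ n)); apply: le_trans (ler_norm _).
  apply: le_trans (G_condensed_ge VE n (wi _ fLp)).
  have W4 : (4 : R) ^+ n <= (u (x_ n) `^ p' * V (x_ n)) `^ p'^-1.
    have p4 : 0 <= (4 : R) ^+ n by rewrite exprn_ge0.
    rewrite -[leLHS](@powRK _ _ p')//; last by rewrite gt_eqF.
    apply: ge0_ler_powR; rewrite ?nnegrE ?powR_ge0 ?invr_ge0 ?(ltW p'_gt0)//.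
      by apply: le_trans (ltW (x_P n)); exact: powR_ge0.
    exact: ltW.
  apply: (@le_trans _ _ (1 / (2 ^ (n + 1))%:R * 4 ^+ n)).
    rewrite natrX addn1 exprS (_ : (4 : R) = 2 * 2) ?exprMn; last by ring.
    rewrite le_eqVlt; apply/orP; left; apply/eqP; field.
    by rewrite expf_neq0// pnatr_eq0.
  by rewrite ler_wpM2l// divr_ge0.
have [n Kn] : exists n : nat, K * 2 < n%:R.
  by exists (Num.truncn (K * 2)).+1; exact: truncnS_gt.
have := KP n; rewrite ler_pdivrMr// leNgt => /negP; apply.
by rewrite (lt_trans Kn)// -natrX ltr_nat ltn_expl.
Qed.

(** If q/r were integrable at -oo, then u^p would be bounded below by a positive
    constant on the half-line (-oo, 0]. *)
Lemma S1_of_lower_tail : lower_tail p u 0 \is a fin_num -> S1 r q = +oo%E.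
Proof.
have c_ge0 : forall x, 0 <= q x / r x by exact: qr_ge0.
move=> Ufin; apply: contrapT => /eqP S1y.
have S1_ge0 : (0 <= S1 r q)%E by apply: integral_ge0 => t _; rewrite lee_fin.
have /fineK S1E : S1 r q \is a fin_num by rewrite ge0_fin_numE// ltey.
set s := fine (S1 r q) in S1E.
have Qs x : x <= 0 -> - s <= Q x.
  move=> x0; rewrite lerNl -[- Q x]add0r -Q0 -massE//.
  rewrite -lee_fin S1E /Rintegral fineK; last first.
    by apply: integrable_fin_num => //; exact: (locint_itv _ _ c_loc).
  apply: ge0_subset_integral => //.
  - apply/measurable_EFinP; apply: measurable_funTS; exact: (locint_measurable c_loc).
  - by move=> t _; rewrite lee_fin.
  - by move=> t /=; rewrite !in_itv/= => /andP[].
suff Uy : (lower_tail p u 0%R = +oo)%E by move: Ufin; rewrite Uy.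
apply/eqP; rewrite -leye_eq.
apply: (@le_trans _ _ (\int[mu]_(t in `]-oo, 0%R]) (expR (p * - s))%:E)%E).
  have muNy : (mu `]-oo, 0%R] = +oo)%E.
    by rewrite (@lebesgue_measure_itv _ `]-oo, 0%R]) /= ltNyr addey.
  apply: (@le_trans _ _ ((expR (p * - s))%:E * mu `]-oo, 0%R])%E).
    by rewrite [X in (_ * X)%E]muNy gt0_muley// lte_fin expR_gt0.
  by rewrite -integral_cst.
apply: ge0_le_integral => //.
- apply: measurable_continuous_EFin; exact: continuous_powR.
- move=> t /=; rewrite in_itv/= => t0.
  by rewrite lee_fin u_powR ler_expR ler_pM2l// Qs.
Qed.

Lemma Mp_ge0 : (0 <= Mp r q p)%E.
Proof.
apply: (@le_trans _ _ (Mpx r q p 0)); last by apply: ereal_sup_ubound; exists 0.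
by rewrite mule_ge0// poweR_ge0.
Qed.

Lemma MpE : (Mp r q p < +oo)%E -> Mp r q p = (fine (Mp r q p))%:E.
Proof. by move=> My; rewrite fineK// ge0_fin_numE// Mp_ge0. Qed.

Lemma Mpx_le_Mp x : (Mpx r q p x <= Mp r q p)%E.
Proof. by apply: ereal_sup_ubound; exists x. Qed.

Lemma Mp_le_bound C : G_bound r q p C -> (Mp r q p <= C%:E)%E.
Proof. by move=> GC; apply: ge_ereal_sup => _ [x _ <-]; exact: Mpx_le_G_bound. Qed.

Lemma G_bound_Mp : (Mp r q p < +oo)%E ->
  G_bound r q p (p `^ p^-1 * p' `^ p'^-1 * fine (Mp r q p)).
Proof.
move=> My.
have [|L [V [LE VE LV]]] := @Mpx_le_tails (fine (Mp r q p)).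
  by move=> x; rewrite -MpE//; exact: Mpx_le_Mp.
exact: (G_bounded_Mp LE VE LV).
Qed.

Lemma solvable_conditions : correctly_solvable r q p ->
  [/\ (Mp r q p < +oo)%E, S1 r q = +oo%E & (Ap r q p < +oo)%E].
Proof.
move=> /(correctly_solvable_G_bound)[[C GC] solG].
have MC := Mp_le_bound GC.
have My : (Mp r q p < +oo)%E by apply: le_lt_trans MC (ltry _).
have [|L [V [LE VE LV]]] := @Mpx_le_tails C.
  by move=> x; apply: le_trans MC; exact: Mpx_le_Mp.
have [||B B0 WB] := upper_tail_bounded_of_G VE.
- exact: (Lfun_weight_integrable VE).
- move=> f /solG [acG _ GNy Gy]; apply: continuous_vanishing_bounded => //.
  exact: abs_continuous_on_continuous.
split=> //; first by apply: S1_of_lower_tail; rewrite LE.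
apply: le_lt_trans (ltry (expR (2 * p') * B)).
exact: Ap_bounded_of_upper_tail.
Qed.

Lemma conditions_solvable : (Mp r q p < +oo)%E -> S1 r q = +oo%E ->
  (Ap r q p < +oo)%E -> correctly_solvable r q p.
Proof.
move=> My S1y Apy.
have [|L [V [LE VE LV]]] := @Mpx_le_tails (fine (Mp r q p)).
  by move=> x; rewrite -MpE//; exact: Mpx_le_Mp.
have wi := Lfun_weight_integrable VE.
have [C [C0 GC]] : exists C, G_bound r q p C by eexists; exact: G_bound_Mp.
have [B B0 WB] := upper_tail_bounded_of_Ap S1y Apy.
have solE f y : f \in Lfun mu p%:E -> is_solution r q f y -> y = G r q f.
  move=> fLp; apply: solution_eq_G => //; last exact: wi.
  exact: Lfun_locint p_gt1 fLp.
split.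
  move=> f fLp; exists (G r q f); split; last by move=> y [sy _]; exact/esym/solE.
  split; last by have [] := GC f fLp.
  apply: G_solution => //; [exact: Lfun_locint p_gt1 fLp|exact: wi|..].
    exact: (G_cvgNy WB fLp (wi f fLp) S1y).
  exact: (G_cvgy WB fLp (wi f fLp)).
exists (C + 1); first by rewrite ltr_wpDl.
move=> f y fLp sy _; rewrite (solE f y fLp sy).
have [_ _] := GC f fLp; move/le_trans; apply.
by apply: lee_wpmul2r; [exact: Lnorm_ge0|rewrite lee_fin lerDl].
Qed.

End first_order_equation.

Theorem theorem2p1 (R : realType) (r q : R -> R) (p : R)
    (r_cont : continuous r) (r_gt0 : forall x, 0 < r x)
    (q_loc : locally_integrable [set: R] q) (q_ge0 : forall x, 0 <= q x)
    (p_gt1 : 1 < p) :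
  (correctly_solvable r q p <->
     [/\ (Mp r q p < +oo)%E, S1 r q = +oo%E & (Ap r q p < +oo)%E]) /\
  ((Mp r q p < +oo)%E <-> G_bounded r q p) /\
  (Mp r q p <= G_opnorm r q p)%E /\
  (G_opnorm r q p <=
     (p `^ p^-1 * conj_exp p `^ (conj_exp p)^-1)%:E * Mp r q p)%E.
Proof.
have p_gt0 : 0 < p by exact: lt_trans p_gt1.
have p'_gt0 : 0 < conj_exp p by exact: lt_trans (conj_exp_gt1 p_gt1).
split.
  split; first exact: solvable_conditions.
  by move=> [My S1y Apy]; exact: conditions_solvable.
split.
  split=> [My|[C GC]]; first by eexists; exact: G_bound_Mp.
  by apply: le_lt_trans (ltry C); exact: Mp_le_bound.
split.
  by apply: le_ereal_inf_tmp => _ [C GC <-]; exact: Mp_le_bound.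
have K0 : 0 < p `^ p^-1 * conj_exp p `^ (conj_exp p)^-1.
  by rewrite mulr_gt0// powR_gt0.
have [My|] := boolP (Mp r q p < +oo)%E; last first.
  by rewrite ltey negbK => /eqP ->; rewrite gt0_muley ?lte_fin// leey.
rewrite [in leRHS](MpE My) -EFinM; apply: ereal_inf_lbound.
by eexists; first exact: G_bound_Mp.
Qed.
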